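(* Let $T$ be an automorphism of a standard probability Borel space $(X,\mathcal{B},\mu)$, $G$ a second countable locally compact Abelian group, $\varphi:X\to G$ a measurable map, $\mathcal{S}=(S_g)_{g\in G}$ a $G$-action on a standard probability Borel space $(Y,\mathcal{C},\nu)$, and $T_{\varphi,\mathcal{S}}(x,y)=(Tx,S_{\varphi(x)}(y))$ on $(X\times Y,\mathcal{B}\otimes\mathcal{C},\mu\otimes\nu)$. Assume that $T$ is mildly mixing. If $\sigma_{\mathcal{S}}(\Sigma_\varphi)=0$, then $T_{\varphi,\mathcal{S}}$ is also mildly mixing.
   Context: An automorphism is an invertible measure-preserving transformation. A $G$-action is a measurable group homomorphism $g\mapsto S_g\in\mathrm{Aut}(Y,\mathcal{C},\nu)$. An automorphism $R$ is rigid if there is a sequence $q_n\to\infty$ with $R^{q_n}\to\mathrm{Id}$ strongly as operators on $L^2$; an automorphism is mildly mixing if it has no non-trivial rigid factor (invariant sub-$\sigma$-algebra, non-trivial mod null sets, on which the induced automorphism is rigid). The spectral measure $\sigma_f$ of $f\in L^2(Y,\mathcal{C},\nu)$ is the finite positive Borel measure on $\widehat{G}$ with $\int_{\widehat{G}}\chi(g)\,d\sigma_f(\chi)=\int_Y f\circ S_g\cdot\overline f\,d\nu$ for all $g\in G$. $\sigma_{\mathcal{S}}$ denotes the maximal spectral type of $\mathcal{S}$ on $L^2_0(Y,\mathcal{C},\nu)$ (zero-mean functions): a finite Borel measure, unique up to equivalence, such that $\sigma_f\ll\sigma_{\mathcal{S}}$ for all $f\in L^2_0$ and $\sigma_{\mathcal{S}}$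 is equivalent to $\sigma_{f}$ for some $f\in L^2_0$. With $\mathbb{T}=\{z\in\mathbb{C}:|z|=1\}$, $$\Sigma_\varphi=\{\chi\in\widehat{G}:\ \chi\circ\varphi=c\cdot\xi/\xi\circ T\ \ \mu\text{-a.e. for a measurable }\xi:X\to\mathbb{T}\text{ and some }c\in\mathbb{T}\},$$ a Borel subgroup of $\widehat{G}$. *)

(* Defs.v *)
From HB Require Import structures.
From mathcomp Require Import all_boot all_order all_algebra.
From mathcomp Require Import complex.
From mathcomp Require Import all_classical all_reals all_analysis.

Set Implicit Arguments.
Unset Strict Implicit.
Unset Printing Implicit Defensive.

Import Order.TTheory GRing.Theory Num.Theory.
Import numFieldNormedType.Exports.

Local Open Scope classical_set_scope.
Local Open Scope complex_scope.
Local Open Scope ring_scope.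

Notation borel T := (g_sigma_algebraType (@open T)).

(* Borel isomorphic to a Polish space. *)
Definition standard_borel (R : realType) d (X : measurableType d) : Prop :=
  exists P : completePseudoMetricType R,
    [/\ hausdorff_space P, @second_countable P &
        exists (f : X -> borel P) (g : borel P -> X),
          [/\ measurable_fun setT f, measurable_fun setT g,
              cancel f g & cancel g f]].

Section ComplexValued.
Context {R : realType} {d} {X : measurableType d}.
Implicit Types (mu : {measure set X -> \bar R}) (f : X -> R[i]).

Definition measurableC f : Prop :=
  measurable_fun setT (fun x => complex.Re (f x)) /\
  measurable_fun setT (fun x => complex.Im (f x)).

Definition integralC mu f : R[i] :=
  (Rintegral mu setT (fun x => complex.Re (f x)))
    +i* (Rintegral mu setT (fun x => complex.Im (f x))).

Definition sqnorm2 mu f : \bar R :=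
  (\int[mu]_x ((ComplexField.Normc.normc (f x)) ^+ 2)%:E)%E.

Definition L2 mu f : Prop := measurableC f /\ (sqnorm2 mu f < +oo)%E.

Definition L20 mu f : Prop := L2 mu f /\ integralC mu f = 0.

End ComplexValued.

Section Automorphisms.
Context {R : realType} {d} {X : measurableType d}.
Variables (mu : {measure set X -> \bar R}) (T : X -> X).

Definition measure_preserving (U : X -> X) : Prop :=
  measurable_fun setT U /\
  forall A, measurable A -> mu (U @^-1` A) = mu A.

(* Elements of Aut(X, mu) are taken modulo null sets, so the inverse is only
   required almost everywhere. *)
Definition automorphism : Prop :=
  measure_preserving T /\
  exists T' : X -> X,
    [/\ measure_preserving T',
        {ae mu, forall x, T' (T x) = x} &
        {ae mu, forall x, T (T' x) = x}].

(* The last two conditions say T^-1 F = F modulo mu-null sets, so that T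
   induces an automorphism of (X, F, mu). *)
Definition factor (F : set (set X)) : Prop :=
  [/\ sigma_algebra setT F, F `<=` measurable,
      (forall A, F A -> exists2 B, F B & mu ((T @^-1` A) `+` B) = 0%E) &
      (forall A, F A -> exists2 B, F B & mu ((T @^-1` B) `+` A) = 0%E)].

(* The automorphism induced by T on F is rigid: T^(q_n) -> Id strongly on
   L^2(X, F, mu).  Since F is a sigma-algebra, [g_sigma_algebraType F] is X
   equipped with F. *)
Definition rigid_on (F : set (set X)) : Prop :=
  exists q : nat -> nat,
    q n @[n --> \oo] --> \oo /\
    forall f : X -> R[i], L2 mu f ->
      measurableC (f : g_sigma_algebraType F -> R[i]) ->
      sqnorm2 mu (fun x => f (iter (q n) T x) - f x) @[n --> \oo] --> 0%E.

Definition trivial_mod_null (F : set (set X)) : Prop :=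
  forall A, F A -> mu A = 0%E \/ mu (~` A) = 0%E.

Definition mildly_mixing : Prop :=
  automorphism /\
  forall F, factor F -> rigid_on F -> trivial_mod_null F.

End Automorphisms.

(* Measurable types are pointed; [pointed_group G] is G pointed at 0. *)
Definition pointed_group (G : topologicalZmodType) : Type := G.
HB.instance Definition _ (G : topologicalZmodType) :=
  Topological.copy (pointed_group G) G.
HB.instance Definition _ (G : topologicalZmodType) :=
  isPointed.Build (pointed_group G) (0 : G).

Notation borel_group G := (borel (pointed_group G)).

Section Dual.
Variables (R : realType) (G : topologicalZmodType).

Definition characters : set {compact-open, G -> (R[i])^o} :=
  [set chi | [/\ continuous (chi : G -> (R[i])^o),
                 (forall g, `|chi g| = 1) &
                 (forall g h, chi (g + h) = chi g * chi h)]].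

(* The dual group, with the topology induced by the compact-open one. *)
Definition dual : Type := set_type characters.
HB.instance Definition _ := Topological.copy dual (set_type characters).

Lemma trivial_character_subproof :
  (fun=> 1 : (R[i])^o) \in characters.
Proof.
apply/mem_set; split=> [|_|_ _]; [exact: cst_continuous|exact: normr1|].
by rewrite mulr1.
Qed.

HB.instance Definition _ :=
  isPointed.Build dual (exist (fun chi => chi \in characters) _ trivial_character_subproof).

Definition character (chi : dual) (g : G) : R[i] :=
  (set_val (chi : set_type characters) : G -> R[i]) g.

End Dual.

Section Spectral.
Context {R : realType} {G : topologicalZmodType}.

(* The homomorphism property holds in Aut(Y, nu), i.e. modulo null sets; joint
   measurability is what makes (x, y) |-> (T x, S_(phi x) y) a measurable
   map. *)
Definition measurable_action {d} {Y : measurableType d}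
    (nu : {measure set Y -> \bar R}) (S : G -> Y -> Y) : Prop :=
  [/\ measurable_fun setT (fun p : borel_group G * Y => S p.1 p.2),
      (forall g, automorphism nu (S g)) &
      (forall g h, {ae nu, forall y, S (g + h) y = S g (S h y)})].

Definition is_spectral_measure {d} {Y : measurableType d}
    (nu : {measure set Y -> \bar R}) (S : G -> Y -> Y) (f : Y -> R[i])
    (tau : {finite_measure set (borel (dual R G)) -> \bar R}) : Prop :=
  forall g : G,
    integralC tau (fun chi => character chi g) =
    integralC nu (fun y => f (S g y) * ((f y)^*)%C).

(* The measures tau are the spectral measures sigma_f, which exist by Bochner's
   theorem and are unique. *)
Definition is_maximal_spectral_type {d} {Y : measurableType d}
    (nu : {measure set Y -> \bar R}) (S : G -> Y -> Y)
    (sigma : {finite_measure set (borel (dual R G)) -> \bar R}) : Prop :=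
  (forall f, L20 nu f ->
     exists2 tau, is_spectral_measure nu S f tau & tau `<< sigma) /\
  (exists2 f, L20 nu f &
     exists2 tau, is_spectral_measure nu S f tau &
       tau `<< sigma /\ sigma `<< tau).

(* This is a Borel subset of the dual, so for a Borel measure it has measure 0
   iff it is negligible. *)
Definition Sigma_group {d} {X : measurableType d}
    (mu : {measure set X -> \bar R}) (T : X -> X) (phi : X -> G) :
    set (borel (dual R G)) :=
  [set chi | exists (c : R[i]) (xi : X -> R[i]),
     [/\ `|c| = 1, measurableC xi, (forall x, `|xi x| = 1) &
         {ae mu, forall x, character chi (phi x) = c * (xi x / xi (T x))}]].

End Spectral.

Definition rokhlin_extension {G X Y : Type} (T : X -> X) (phi : X -> G)
    (S : G -> Y -> Y) (p : X * Y) : X * Y :=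
  (T p.1, S (phi p.1) p.2).

(* Main.v *)
Require Import Defs.
From HB Require Import structures.
From mathcomp Require Import all_boot all_order all_algebra.
From mathcomp Require Import complex ring lra.
From mathcomp Require Import all_classical all_reals all_analysis measurable_realfun.

Set Implicit Arguments.
Unset Strict Implicit.
Unset Printing Implicit Defensive.

Import Order.TTheory GRing.Theory Num.Theory.
Import numFieldNormedType.Exports.

Local Open Scope classical_set_scope.
Local Open Scope ring_scope.

(* Let [A] belong to a rigid factor of the extension, with rigidity times [q n].
   The fibre measures [nu (A_x)] form a rigid function for [T], so they are almost
   surely equal to a constant [c]. Next, [\1_A] is orthogonal to [a(x) f(y)] for
   every [f] of zero mean: in the spectral representation of the cyclic space of
   [f], the Koopman operator of the extension acts on [L^2(mu \x sigma_f)] by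
   [h(x, chi) |-> chi (phi x) h(T x, chi)], and the projection of [\1_A] becomes a
   vector [h] that is rigid along [q n]. Thus, for almost every [chi], the function
   [h(., chi)] is rigid for the operator twisted by [chi]. If it is not zero, mild
   mixing of [T] makes its modulus constant and then makes
   [chi (phi x) h(T x, chi) / h(x, chi)] constant, so [chi] is in [Sigma_phi], a
   null set. Hence [A] meets every rectangle [B `*` C] in a set of measure
   [c mu(B) nu(C)], so [A] is independent of itself. *)

(** * Measure-preserving maps, bounded functions and almost everywhere statements *)

(** Why the projected vector is rigid: let [h] represent the pairing with [\1_A] on the closed span
    of the forward iterates of [a(x) f(y)], and let [V_n] be the [q n]-th power of the Koopman
    operator. Then [<h, V_n h> = <\1_A, V_n h>], and this tends to [<\1_A, h> = |h|^2] because [V_n]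
    is isometric and almost fixes [\1_A]; so [|V_n h - h|^2 = 2 |h|^2 - 2 <h, V_n h>] tends to 0.
    Forward invariance of the span suffices for this, so its elements can be encoded by polynomials.
    The obstacle is the passage to single characters: convergence in the mean on [mu \x sigma_f]
    says nothing about a fixed [chi]. Approximations are therefore made at a geometric rate along a
    subsequence of times, which gives convergence at almost every point, and Fubini then isolates
    [chi]. This is also why mild mixing is used in a form that assumes pointwise convergence. *)

Section MeasurePreserving.
Context {R : realType} {d} {X : measurableType d}.
Variable mu : {measure set X -> \bar R}.

Lemma measure_preserving_id : measure_preserving mu id.
Proof. by split => // ; exact: measurable_id. Qed.

Lemma measure_preserving_comp U V :
  measure_preserving mu U -> measure_preserving mu V ->
  measure_preserving mu (U \o V).
Proof.
move=> [mU pU] [mV pV]; split; first exact: measurableT_comp.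
move=> A mA; rewrite comp_preimage pV ?pU//.
by rewrite -[X in measurable X]setTI; exact: mU.
Qed.

Lemma measure_preserving_iter U n :
  measure_preserving mu U -> measure_preserving mu (iter n U).
Proof.
move=> pU; elim: n => [|n ih]; first exact: measure_preserving_id.
exact: measure_preserving_comp.
Qed.

Lemma ae_measure_preserving U (P : X -> Prop) : measure_preserving mu U ->
  {ae mu, forall x, P x} -> {ae mu, forall x, P (U x)}.
Proof.
move=> [mU pU] [N [mN N0 PN]]; exists (U @^-1` N); split.
- by rewrite -[X in measurable X]setTI; exact: mU.
- by rewrite pU.
- by move=> x /= nP; exact: PN.
Qed.

Lemma ge0_integral_measure_preserving U (f : X -> \bar R) :
  measure_preserving mu U -> measurable_fun setT f -> (forall x, (0 <= f x)%E) ->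
  (\int[mu]_x f (U x) = \int[mu]_x f x)%E.
Proof.
move=> [mU pU] mf f0.
have := @ge0_integral_pushforward _ _ X X R U mU mu setT f measurableT mf
  (fun y _ => f0 y).
rewrite preimage_setT => h; apply: etrans (esym h) _.
by apply: eq_measure_integral => A mA _; exact: pU.
Qed.

Lemma integral_measure_preserving U (f : X -> \bar R) :
  measure_preserving mu U -> measurable_fun setT f ->
  (\int[mu]_x f (U x) = \int[mu]_x f x)%E.
Proof.
move=> pU mf; rewrite integralE [RHS]integralE.
congr (_ - _)%E.
  rewrite -(@ge0_integral_measure_preserving U f^\+%E)//.
    by apply: eq_integral => x _; rewrite !funeposE.
  exact: measurable_funepos.
rewrite -(@ge0_integral_measure_preserving U f^\-%E)//.
  by apply: eq_integral => x _; rewrite !funenegE.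
exact: measurable_funeneg.
Qed.

Lemma Rintegral_measure_preserving U (f : X -> R) :
  measure_preserving mu U -> measurable_fun setT f ->
  \int[mu]_x f (U x) = \int[mu]_x f x.
Proof.
move=> pU mf; rewrite /Rintegral; congr fine.
by rewrite (integral_measure_preserving (f := EFin \o f))//; apply/measurable_EFinP.
Qed.

End MeasurePreserving.

Section BoundedMeasurable.
Context {R : realType} {d} {X : measurableType d}.
Implicit Types f g : X -> R.

(** Unlike integrability, this class is stable under products, and it gives integrability for every
    finite measure. Indicators, components of characters and finite combinations of iterates stay in
    it. *)
Definition bounded_measurable f :=
  measurable_fun setT f /\ exists M, forall x, `|f x| <= M.

Lemma bounded_measurableD f g : bounded_measurable f -> bounded_measurable g ->
  bounded_measurable (fun x => f x + g x).
Proof.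
move=> [mf [M fM]] [mg [N gN]]; split; first exact: measurable_funD.
by exists (M + N) => x; rewrite (le_trans (ler_normD _ _))// lerD.
Qed.

Lemma bounded_measurableM f g : bounded_measurable f -> bounded_measurable g ->
  bounded_measurable (fun x => f x * g x).
Proof.
move=> [mf [M fM]] [mg [N gN]]; split; first exact: measurable_funM.
by exists (M * N) => x; rewrite normrM ler_pM.
Qed.

Lemma bounded_measurable_cst (c : R) : bounded_measurable (fun=> c).
Proof. by split; [exact: measurable_cst|exists `|c|]. Qed.

Lemma bounded_measurableZ c f : bounded_measurable f ->
  bounded_measurable (fun x => c * f x).
Proof. by move=> ?; apply: bounded_measurableM => //; exact: bounded_measurable_cst. Qed.

Lemma bounded_measurableB f g : bounded_measurable f -> bounded_measurable g ->
  bounded_measurable (fun x => f x - g x).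
Proof.
move=> [mf [M fM]] [mg [N gN]]; split; first exact: measurable_funB.
by exists (M + N) => x; rewrite (le_trans (ler_normB _ _))// lerD.
Qed.

Lemma bounded_measurable_sum I (r : seq I) (P : pred I) (f : I -> X -> R) :
  (forall i, bounded_measurable (f i)) ->
  bounded_measurable (fun x => \sum_(i <- r | P i) f i x).
Proof.
move=> bf; elim: r => [|i r ih].
  under eq_fun do rewrite big_nil; exact: bounded_measurable_cst.
under eq_fun do rewrite big_cons.
by case: (P i) => //; exact: bounded_measurableD.
Qed.

Lemma bounded_measurable_indic (A : set X) : measurable A ->
  bounded_measurable (\1_A : X -> R).
Proof.
move=> mA; split; first exact: measurable_indic.
by exists 1 => x; rewrite indicE; case: (_ \in _); rewrite ?normr1 ?normr0.
Qed.

Lemma bounded_measurable_integrable (mu : {finite_measure set X -> \bar R}) f :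
  bounded_measurable f -> mu.-integrable setT (EFin \o f).
Proof.
move=> [mf [M fM]]; apply: measurable_bounded_integrable => //.
  by rewrite -ge0_fin_numE// fin_num_measure.
exists M; split; first exact: num_real.
by move=> y My x _ /=; rewrite (le_trans (fM x))// ltW.
Qed.

Lemma Rintegral_sum (mu : {finite_measure set X -> \bar R})
    I (r : seq I) (P : pred I) (f : I -> X -> R) :
  (forall i, bounded_measurable (f i)) ->
  \int[mu]_x (\sum_(i <- r | P i) f i x) = \sum_(i <- r | P i) \int[mu]_x f i x.
Proof.
move=> bf; elim: r => [|i r ih].
  under eq_Rintegral do rewrite big_nil.
  by rewrite big_nil /Rintegral integral0.
under eq_Rintegral do rewrite big_cons.
rewrite big_cons; case: (P i) => //.
rewrite RintegralD// ?ih//; apply: bounded_measurable_integrable => //.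
exact: bounded_measurable_sum.
Qed.

Lemma EFin_Rintegral (mu : {finite_measure set X -> \bar R}) f :
  bounded_measurable f -> ((\int[mu]_x f x)%:E = \int[mu]_x (f x)%:E)%E.
Proof.
move=> bf; rewrite /Rintegral fineK//.
by have := integrable_fin_num measurableT (bounded_measurable_integrable mu bf).
Qed.

End BoundedMeasurable.

Lemma bounded_measurable_comp {R : realType} {d d'} {X : measurableType d}
    {Y : measurableType d'} (f : Y -> R) (g : X -> Y) :
  bounded_measurable f -> measurable_fun setT g -> bounded_measurable (f \o g).
Proof.
move=> [mf [M fM]] mg; split; first exact: measurableT_comp.
by exists M => x /=.
Qed.

Section FastConvergence.
Context {R : realType} {d} {X : measurableType d}.
Variable mu : {measure set X -> \bar R}.

(** The sum of the series has an integral bounded by a geometric sum, so it is finite almost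
    everywhere. *)
Lemma ae_cvg_series (f : nat -> X -> R) (C : R) :
  (forall n, measurable_fun setT (f n)) -> (forall n x, 0 <= f n x) ->
  (forall n, (\int[mu]_x (f n x)%:E <= (C * 2^-1 ^+ n)%:E)%E) ->
  {ae mu, forall x, cvgn (series (f ^~ x))}.
Proof.
move=> mf f0 fC.
pose g x := (\sum_(n <oo) (f n x)%:E)%E.
have g0 x : (0 <= g x)%E by apply: nneseries_ge0 => *; rewrite lee_fin.
have mEf n : measurable_fun setT (EFin \o f n) by apply/measurable_EFinP.
have intg : (\int[mu]_x g x < +oo)%E.
  rewrite integral_nneseries//; last by move=> *; rewrite lee_fin.
  have C0 : 0 <= C.
    have := fC 0%N; rewrite expr0 mulr1 => h; rewrite -lee_fin (le_trans _ h)//.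
    by apply: integral_ge0 => *; rewrite lee_fin.
  apply: (@le_lt_trans _ _ (\sum_(n <oo) (C * 2^-1 ^+ n)%:E)%E).
    by apply: lee_nneseries => // n _ _; apply: integral_ge0 => *; rewrite lee_fin.
  have := @is_cvg_geometric_series R C 2^-1.
  rewrite ger0_norm// invf_lt1 ?ltr1n// => /(_ isT) cv.
  rewrite (_ : (\sum_(n <oo) _)%E = (limn (series (geometric C 2^-1)))%:E) ?ltry//.
  rewrite -EFin_lim//; congr (limn _); apply/funext => n.
  by rewrite /= /series /= -sumEFin.
have ig : mu.-integrable setT g.
  apply/integrableP; split.
    by apply: ge0_emeasurable_sum => [k x _ _|k _]; [rewrite lee_fin|exact: mEf].
  by under eq_integral do rewrite gee0_abs//.
have := integrable_ae measurableT ig; apply: filterS => x /(_ I) gfin.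
apply: nondecreasing_is_cvgn.
  by apply/nondecreasing_series => n _ _; exact: f0.
exists (fine (g x)) => _ [n _ <-]; rewrite -lee_fin fineK// /series /= -sumEFin.
by apply: nneseries_lim_ge => *; rewrite lee_fin.
Qed.

Lemma ae_cvg0 (f : nat -> X -> R) (C : R) :
  (forall n, measurable_fun setT (f n)) -> (forall n x, 0 <= f n x) ->
  (forall n, (\int[mu]_x (f n x)%:E <= (C * 2^-1 ^+ n)%:E)%E) ->
  {ae mu, forall x, f n x @[n --> \oo] --> 0}.
Proof.
move=> mf f0 fC; have := ae_cvg_series mf f0 fC.
by apply: filterS => x /cvg_series_cvg_0.
Qed.

End FastConvergence.

Section FubiniAe.
Context {R : realType} {d1 d2} {X : measurableType d1} {Y : measurableType d2}.
Variables (mu : {sigma_finite_measure set X -> \bar R})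
          (nu : {sigma_finite_measure set Y -> \bar R}).

Lemma ae_xsection (P : X * Y -> Prop) : {ae (mu \x nu)%E, forall p, P p} ->
  {ae mu, forall x, {ae nu, forall y, P (x, y)}}.
Proof.
move=> [N [mN N0 PN]].
have h : (\int[mu]_x `|nu (xsection N x)| = 0)%E.
  by rewrite -N0; apply: eq_integral => x _; rewrite gee0_abs.
have := (@ae_eq_integral_abs _ _ _ mu setT measurableT (nu \o xsection N)
  (measurable_fun_xsection nu mN)).1 h.
apply: filterS => x /(_ I) /= Nx0; exists (xsection N x); split => //.
  exact: measurable_xsection.
by move=> y /= nP; apply/xsectionP; exact: PN.
Qed.

Lemma ae_ysection (P : X * Y -> Prop) : {ae (mu \x nu)%E, forall p, P p} ->
  {ae nu, forall y, {ae mu, forall x, P (x, y)}}.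
Proof.
move=> [N [mN N0 PN]].
have h : (\int[nu]_y `|mu (ysection N y)| = 0)%E.
  (* [mu \x nu] integrates the measures of the sections over [x]; uniqueness of the product measure
     allows integrating over [y] instead. *)
  rewrite -N0; transitivity ((mu \x^ nu)%E N).
    by apply: eq_integral => x _; rewrite gee0_abs.
  apply: esym; apply: product_measure_unique => //= A B mA mB.
  by rewrite product_measure2E.
have := (@ae_eq_integral_abs _ _ _ nu setT measurableT (mu \o ysection N)
  (measurable_fun_ysection mu mN)).1 h.
apply: filterS => x /(_ I) /= Nx0; exists (ysection N x); split => //.
  exact: measurable_ysection.
by move=> y /= nP; apply/ysectionP; exact: PN.
Qed.

(** The exceptional null sets may vary with [x]: measurability of [P] makes the measure of the bad
    set the integral of the measures of its sections, almost all of which vanish. *)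
Lemma ae_product (P : set (X * Y)) : measurable P ->
  {ae mu, forall x, {ae nu, forall y, P (x, y)}} ->
  {ae (mu \x nu)%E, forall p, P p}.
Proof.
move=> mP h; exists (~` P); split => //; first exact: measurableC.
apply: (etrans (y := \int[mu]_x `|(nu \o xsection (~` P)) x|)%E).
  by apply: eq_integral => x _; rewrite gee0_abs.
apply/ae_eq_integral_abs => //.
  by apply: measurable_fun_xsection; exact: measurableC.
apply: filterS h => x hx _ /=; apply: measure_negligible.
  by apply: measurable_xsection; exact: measurableC.
apply: negligibleS hx => y /= /set_mem; exact.
Qed.

Lemma ae_product_swap (P : set (X * Y)) : measurable P ->
  {ae nu, forall y, {ae mu, forall x, P (x, y)}} ->
  {ae (mu \x nu)%E, forall p, P p}.
Proof.
move=> mP h; exists (~` P); split => //; first exact: measurableC.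
rewrite (_ : (mu \x nu)%E _ = (mu \x^ nu)%E (~` P)); last first.
  apply: product_measure_unique => //=; last exact: measurableC.
  by move=> A B mA mB; rewrite product_measure2E.
apply: (etrans (y := \int[nu]_x `|(mu \o ysection (~` P)) x|)%E).
  by apply: eq_integral => x _; rewrite gee0_abs.
apply/ae_eq_integral_abs => //.
  by apply: measurable_fun_ysection; exact: measurableC.
apply: filterS h => x hx _ /=; apply: measure_negligible.
  by apply: measurable_ysection; exact: measurableC.
by apply: negligibleS hx => y /= /set_mem; exact.
Qed.

End FubiniAe.

(** Bounds of order [4^-1 ^+ n] leave room for a weight [2 ^+ n] on the squared increments, whose
    weighted sum is still finite almost everywhere; this forces absolute convergence of the
    increments. Fatou carries the rate over to the limit. *)
Lemma fast_L2_limit {R : realType} {d} {Z : measurableType d}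
    (mu : {measure set Z -> \bar R}) (u : nat -> Z -> R) (C : R) :
  (forall n, measurable_fun setT (u n)) ->
  (forall n m, (n <= m)%N ->
     (\int[mu]_z ((u m z - u n z) ^+ 2)%:E <= (C * 4^-1 ^+ n)%:E)%E) ->
  exists h : Z -> R, [/\ measurable_fun setT h,
    {ae mu, forall z, u n z @[n --> \oo] --> h z} &
    forall n, (\int[mu]_z ((h z - u n z) ^+ 2)%:E <= (C * 4^-1 ^+ n)%:E)%E].
Proof.
move=> mu_ uC.
have msq n m : measurable_fun setT (fun z => (u m z - u n z) ^+ 2).
  by apply/measurable_funX/measurable_funB.
have cs : {ae mu, forall z, cvgn (series (fun n => 2 ^+ n * (u n.+1 z - u n z) ^+ 2))}.
  apply: (ae_cvg_series (C := C)) => [n|n z|n].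
  - by apply: measurable_funM => //; exact: msq.
  - by rewrite mulr_ge0 ?sqr_ge0// exprn_ge0.
  under eq_integral do rewrite EFinM.
  rewrite ge0_integralZl_EFin ?exprn_ge0//; last 2 first.
  - by move=> z _; rewrite lee_fin sqr_ge0.
  - exact/measurable_EFinP/msq.
  apply: (@le_trans _ _ ((2 ^+ n)%:E * (C * 4^-1 ^+ n)%:E)%E).
    by apply: lee_wpmul2l; [rewrite lee_fin exprn_ge0|exact: uC].
  rewrite -EFinM lee_fin mulrCA -exprMn (_ : 2 * 4^-1 = 2^-1)//.
  by field.
have cu : {ae mu, forall z, cvgn (u ^~ z)}.
  apply: filterS cs => z cz.
  have geo : cvgn (series (fun n => (2^-1 : R) ^+ n)).
    have := @is_cvg_geometric_series R 1 2^-1.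
    rewrite ger0_norm// invf_lt1 ?ltr1n// => /(_ isT).
    by rewrite /geometric; under eq_fun do rewrite mul1r.
  have cD : cvgn (series (fun n => u n.+1 z - u n z)).
    apply: normed_cvg; apply: (@series_le_cvg _ _
      (fun n => 2 ^+ n * (u n.+1 z - u n z) ^+ 2 + 2^-1 ^+ n)) => [n|n|n|].
    - exact: normr_ge0.
    - by rewrite addr_ge0 ?exprn_ge0// mulr_ge0 ?sqr_ge0// exprn_ge0.
    (* With [t = 2 ^+ n], either [D <= t^-1] or [D <= t * D ^+ 2]. *)
    - rewrite /= exprVn -[_ ^+ 2]real_normK ?num_real//.
      move: `|_| (normr_ge0 (u n.+1 z - u n z)) => D D0.
      have t0 : 0 < (2 : R) ^+ n by rewrite exprn_gt0.
      move: (2 ^+ n) t0 => t t0; have [Dt|tD] := leP D t^-1.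
        by apply: ler_wpDl => //; apply: mulr_ge0; [exact: ltW|exact: sqr_ge0].
      apply: ler_wpDr; first by rewrite invr_ge0 ltW.
      rewrite expr2 mulrA ler_peMl//.
      by rewrite -(mulfV (lt0r_neq0 t0)) ler_pM2l// ltW.
    rewrite (_ : (fun n => _) = (fun n => 2 ^+ n * (u n.+1 z - u n z) ^+ 2) \+ (fun n => 2^-1 ^+ n))//.
    by rewrite seriesD; apply: is_cvgD.
  have uE : (u ^~ z) = (fun n => u 0%N z + series (fun n => u n.+1 z - u n z) n).
    apply/funext => n; rewrite /series /= telescope_sumr//; ring.
  by rewrite uE; apply: is_cvgD => //; exact: is_cvg_cst.
(* The upper limit is measurable on the whole space and agrees with the limit wherever the sequence
   converges. *)
pose h z := fine (limn_esup (fun n => (u n z)%:E)).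
have mh : measurable_fun setT h.
  apply: measurableT_comp => //.
  by apply: measurable_fun_limn_esup => n; exact/measurable_EFinP.
have ch : {ae mu, forall z, u n z @[n --> \oo] --> h z}.
  apply: filterS cu => z /cvg_ex[l ul].
  have cl : (u n z)%:E @[n --> \oo] --> l%:E by apply/fine_cvgP; split => //; exact: nearW.
  by rewrite /h is_cvg_limn_esupE ?(cvg_lim _ cl)//; apply/cvg_ex; exists l%:E.
exists h; split => // n.
have mhn m : measurable_fun setT (fun z => ((h z - u m z) ^+ 2)%:E).
  by apply/measurable_EFinP/measurable_funX/measurable_funB.
have mE m : measurable_fun setT (fun z => ((u m z - u n z) ^+ 2)%:E).
  exact/measurable_EFinP/msq.
apply: (@le_trans _ _ (\int[mu]_z limn_einf (fun m => ((u m z - u n z) ^+ 2)%:E))%E).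
  rewrite le_eqVlt; apply/orP; left; apply/eqP; apply: ge0_ae_eq_integral => //.
  - rewrite (_ : (fun z => _) = -%E \o (fun z => limn_esup (fun m => - ((u m z - u n z) ^+ 2)%:E)%E)).
      apply: measurableT_comp => //; apply: measurable_fun_limn_esup => m.
      exact: measurableT_comp.
    by apply/funext => z.
  - by move=> z _; rewrite lee_fin sqr_ge0.
  - move=> z _; rewrite limn_einf_lim; apply: lime_ge; first exact: is_cvg_einfs.
    apply: nearW => k; apply: le_ereal_inf_tmp => _ [m _ <-].
    by rewrite lee_fin sqr_ge0.
  apply: filterS ch => z cz _.
  have cl : ((u m z - u n z) ^+ 2)%:E @[m --> \oo] --> ((h z - u n z) ^+ 2)%:E.
    apply/fine_cvgP; split => /=; first exact: nearW.
    by rewrite expr2; under eq_fun do rewrite /= expr2; apply: cvgM; apply: cvgB => //; exact: cvg_cst.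
  by rewrite is_cvg_limn_einfE ?(cvg_lim _ cl)//; apply/cvg_ex; exists ((h z - u n z) ^+ 2)%:E.
apply: (le_trans (fatou _ _ _ _)) => // [m z _|]; first by rewrite lee_fin sqr_ge0.
rewrite limn_einf_lim; apply: lime_le; first exact: is_cvg_einfs.
(* The index [maxn n k] lies beyond [k], as the tail infimum requires, and beyond [n], as the bound
   requires. *)
apply: nearW => k; apply: (@le_trans _ _ (\int[mu]_z ((u (maxn n k) z - u n z) ^+ 2)%:E)%E).
  by apply: ereal_inf_lbound; exists (maxn n k) => //=; exact: leq_maxr.
by apply: uC; exact: leq_maxl.
Qed.

(** * Riesz representation by a fast maximising sequence *)

Section Minimisation.
Context {R : realType} {V : lmodType R}.
(** [B] may be degenerate and [V] incomplete, so the representative of [l] is only available as a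
    sequence. By scaling [u], the bound [lB] amounts to [l u ^+ 2 <= B u u]. *)
Variables (B : V -> V -> R) (l : V -> R) (U : nat -> V -> V).
Hypotheses (BD : forall u v w, B (u + v) w = B u w + B v w)
  (BZ : forall a u v, B (a *: u) v = a * B u v)
  (Bsym : forall u v, B u v = B v u)
  (B0 : forall u, 0 <= B u u)
  (lD : forall u v, l (u + v) = l u + l v)
  (lZ : forall a u, l (a *: u) = a * l u)
  (lB : forall u, 2 * l u - B u u <= 1)
  (BU : forall n u, B (U n u) (U n u) = B u u)
  (lU : forall u : V, l (U n u) @[n --> \oo] --> l u).

Let J u := 2 * l u - B u u.

Let BDr u v w : B w (u + v) = B w u + B w v.
Proof. by rewrite Bsym BD !(Bsym w). Qed.

Let BZr a u v : B v (a *: u) = a * B v u.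
Proof. by rewrite Bsym BZ Bsym. Qed.

Let JDZ u v t : J (u + t *: v) = J u + 2 * t * (l v - B u v) - t ^+ 2 * B v v.
Proof. by rewrite /J lD lZ !(BD, BDr, BZ, BZr) (Bsym v u); ring. Qed.

(** Parallelogram law: two near-maximisers of [J] are close for [B], because their midpoint cannot
    exceed the supremum. *)
Let Jmid u v : J (2^-1 *: (u + v)) = (J u + J v) / 2 + B (v - u) (v - u) / 4.
Proof.
rewrite -scaleN1r /J lZ !(BD, BDr, BZ, BZr) lD (Bsym v u).
by field.
Qed.

(* [J u] is the gap between the squared norm of the Riesz representative of [l]
   and its squared distance to [u]; the sequence [p] maximises it at a
   geometric rate. *)
Lemma fast_Riesz_sequence : exists (p : nat -> V) (k : nat -> nat) (C : R),
  [/\ forall n, (n <= k n)%N,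
      forall n m, (n <= m)%N -> B (p m - p n) (p m - p n) <= C * 4^-1 ^+ n,
      forall n, B (U (k n) (p n) - p n) (U (k n) (p n) - p n) <= C * 4^-1 ^+ n &
      forall w n, `|l w - B (p n) w| <= 4^-1 ^+ n * (1 + B w w)].
Proof.
pose m := sup (range J).
have l0 : l 0 = 0 by rewrite -(scale0r (0 : V)) lZ mul0r.
have B00 : B 0 0 = 0 by rewrite -(scale0r (0 : V)) BZ mul0r.
have hs : has_sup (range J).
  split; first by exists (J 0); exists 0.
  by exists 1 => _ [u _ <-]; exact: lB.
have Jm u : J u <= m by apply: ub_le_sup; [exact: hs.2|exists u].
have d0 n : 0 < (4^-1 : R) ^+ n by apply: exprn_gt0; lra.
(* The gap is the square of the desired rate: [near_l] perturbs by [t *: w] with [t] equal to plus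
   or minus [4^-1 ^+ n], and dividing by [t] costs one factor. *)
have /choice[p pJ] : forall n, exists u, m - (4^-1 ^+ n) ^+ 2 < J u.
  move=> n; have /(sup_adherent)/(_ hs)[_ [u _ <-] h] : 0 < ((4^-1 : R) ^+ n) ^+ 2.
    exact: exprn_gt0.
  by exists u.
have near_l w n : `|l w - B (p n) w| <= 4^-1 ^+ n * (1 + B w w) / 2.
  have h t : 2 * t * (l w - B (p n) w) <= (4^-1 ^+ n) ^+ 2 + t ^+ 2 * B w w.
    have := Jm (p n + t *: w); have := pJ n; rewrite JDZ; lra.
  have := h (4^-1 ^+ n); have := h (- 4^-1 ^+ n); rewrite sqrrN.
  move: (4^-1 ^+ n) (d0 n) => e e0 ha hb.
  rewrite ler_norml; apply/andP; split.
    by rewrite -(ler_pM2l e0); move: ha; lra.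
  by rewrite -(ler_pM2l e0); move: hb; lra.
(* Here [J (p n) >= -1], and [lB] at [2^-1 *: p n] gives [l (p n) <= 1 + B (p n) (p n) / 4]; so
   [B = 2 l - J <= 3 + B / 2] at [p n]. *)
have Bp n : B (p n) (p n) <= 6.
  have J0 : -1 <= J (p n).
    have := pJ n; have : 0 <= m by rewrite (le_trans _ (Jm 0))// /J l0 B00; lra.
    have : ((4^-1 : R) ^+ n) ^+ 2 <= 1.
      have : (4^-1 : R) ^+ n <= 1 by rewrite exprn_ile1; lra.
      by move=> e1; rewrite expr2 -[leRHS]mulr1 ler_pM// ltW.
    by lra.
  have := lB (2^-1 *: p n); rewrite lZ BZ BZr; move: J0; rewrite /J; lra.
have /choice[k kP] : forall n, exists k, (n <= k)%N /\
    `|l (U k (p n)) - l (p n)| <= 4^-1 ^+ n.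
  move=> n; have /cvgrPdist_le/(_ _ (d0 n)) := @lU (p n).
  case=> N _ hN; exists (maxn N n); split; first exact: leq_maxr.
  by rewrite distrC; apply: hN => /=; exact: leq_maxl.
(* The Cauchy bound holds already with 4. The displacement bound gives 16: twice the sum of two
   errors [7 / 2] from [near_l], where [1 + B (p n) (p n) <= 7], and of an error 1 from the choice
   of [k n]. *)
exists p, k, 16; split.
- by move=> n; case: (kP n).
- move=> n k' nk; have := Jm (2^-1 *: (p n + p k')); rewrite Jmid.
  have := pJ n; have := pJ k'.
  have sq1 i : ((4^-1 : R) ^+ i) ^+ 2 <= 4^-1 ^+ i.
    by rewrite expr2 ler_piMr// ?exprn_ile1// ?ltW//; lra.
  have : (4^-1 : R) ^+ k' <= 4^-1 ^+ n by apply: ler_wiXn2l => //; lra.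
  move: (sq1 n) (sq1 k') (B0 (p k' - p n)) (d0 n); lra.
- move=> n; case: (kP n) => _ hk.
  have -> : B (U (k n) (p n) - p n) (U (k n) (p n) - p n) =
      2 * (B (p n) (p n) - B (p n) (U (k n) (p n))).
    rewrite -scaleN1r !(BD, BDr, BZ, BZr) BU (Bsym (U _ _)); ring.
  have := near_l (U (k n) (p n)) n; have := near_l (p n) n.
  rewrite BU; move: (4^-1 ^+ n) (d0 n) hk => e e0.
  rewrite !ler_norml => /andP[a1 a2] /andP[b1 b2] /andP[c1 c2].
  have : e * (1 + B (p n) (p n)) <= e * 7 by rewrite ler_pM2l//; have := Bp n; lra.
  by lra.
- move=> w n; apply: (le_trans (near_l w n)).
  rewrite ler_pdivrMr// ler_peMr; [by []| |lra].
  by rewrite mulr_ge0 ?ltW// ltr_wpDr.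
Qed.

End Minimisation.

(** * Rigid functions and mild mixing *)

Lemma ge0_cvge0P {R : realType} (u : nat -> \bar R) : (forall n, (0 <= u n)%E) ->
  (u n @[n --> \oo] --> 0%E) <->
  (forall e : R, 0 < e -> \forall n \near \oo, (u n <= e%:E)%E).
Proof.
move=> u0; split.
  move=> /fine_cvgP[fu /cvgrPdist_le cu] e e0.
  near=> n; have fun_n : u n \is a fin_num by near: n.
  have : `|0 - fine (u n)| <= e by near: n; exact: cu.
  rewrite sub0r normrN => h.
  by rewrite -(fineK fun_n) lee_fin (le_trans (ler_norm _)).
move=> h; apply/fine_cvgP; split.
  near=> n; rewrite ge0_fin_numE//; apply: (@le_lt_trans _ _ 1%:E); last exact: ltry.
  by near: n; exact: h.
apply/cvgrPdist_le => e e0; near=> n.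
rewrite sub0r normrN ger0_norm ?fine_ge0//.
have ue : (u n <= e%:E)%E by near: n; exact: h.
by rewrite -lee_fin fineK// ge0_fin_numE// (le_lt_trans ue)// ltry.
Unshelve. all: by end_near. Qed.

Section Rigidity.
Context {R : realType} {d} {X : measurableType d}.
Variables (mu : probability X R) (U : nat -> X -> X).
Hypothesis pU : forall n, measure_preserving mu (U n).

Definition rigid_function (s : X -> R) := measurable_fun setT s /\
  (\int[mu]_x ((s (U n x) - s x) ^+ 2)%:E)%E @[n --> \oo] --> 0%E.

(** When [U n] is the [q n]-th iterate of an automorphism, this is its largest factor that is rigid
    along [q]. Mild mixing is applied to it, which turns rigidity of a single set into
    triviality. *)
Definition rigid_sets : set (set X) :=
  [set A | measurable A /\ rigid_function (\1_A : X -> R)].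

Let mUf n (s : X -> R) : measurable_fun setT s -> measurable_fun setT (s \o U n).
Proof. by move=> ms; apply: measurableT_comp => //; case: (pU n). Qed.

Let msq n (s : X -> R) : measurable_fun setT s ->
  measurable_fun setT (fun x => ((s (U n x) - s x) ^+ 2)%:E).
Proof.
move=> ms; apply/measurable_EFinP/measurable_funX; apply: measurable_funB => //.
exact: mUf.
Qed.

Let sq0 n (s : X -> R) : (0 <= \int[mu]_x ((s (U n x) - s x) ^+ 2)%:E)%E.
Proof. by apply: integral_ge0 => x _; rewrite lee_fin sqr_ge0. Qed.

Lemma rigid_functionZ c s : rigid_function s -> rigid_function (fun x => c * s x).
Proof.
move=> [ms rs]; split; first exact: measurable_funM.
rewrite (_ : (fun n => _) = fun n =>
    ((c ^+ 2)%:E * \int[mu]_x ((s (U n x) - s x) ^+ 2)%:E)%E); last first.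
  apply/funext => n; rewrite -ge0_integralZl_EFin ?sqr_ge0//; last 2 first.
  - by move=> x _; rewrite lee_fin sqr_ge0.
  - exact: (msq n ms).
  by apply: eq_integral => x _; rewrite -EFinM -mulrBr exprMn.
by rewrite -[X in _ --> X](mule0 (c ^+ 2)%:E); apply: cvgeZl.
Qed.

Lemma rigid_functionD s t : rigid_function s -> rigid_function t ->
  rigid_function (fun x => s x + t x).
Proof.
move=> [ms rs] [mt rt]; split; first exact: measurable_funD.
apply/ge0_cvge0P => [n|e e0].
  by apply: integral_ge0 => x _; rewrite lee_fin sqr_ge0.
have e4 : 0 < e / 4 by rewrite divr_gt0.
near=> n.
have msn := msq n ms.
have hs : (\int[mu]_x ((s (U n x) - s x) ^+ 2)%:E <= (e / 4)%:E)%E.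
  by near: n; move/ge0_cvge0P : rs; exact.
have mtn := msq n mt.
have ht : (\int[mu]_x ((t (U n x) - t x) ^+ 2)%:E <= (e / 4)%:E)%E.
  by near: n; move/ge0_cvge0P : rt; exact.
apply: (@le_trans _ _ (\int[mu]_x (2%:E * ((s (U n x) - s x) ^+ 2)%:E +
    2%:E * ((t (U n x) - t x) ^+ 2)%:E))%E).
  apply: ge0_le_integral => //.
  - by move=> x _; rewrite lee_fin sqr_ge0.
  - exact: (msq n (measurable_funD ms mt)).
  - by apply: emeasurable_funD; exact: measurable_funeM.
  move=> x _; rewrite -!EFinM -EFinD lee_fin.
  have := sqr_ge0 ((s (U n x) - s x) - (t (U n x) - t x)); lra.
rewrite ge0_integralD//; try exact: measurable_funeM;
  try by move=> x _; rewrite -EFinM lee_fin mulr_ge0// sqr_ge0.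
rewrite !ge0_integralZl_EFin//; try by move=> x _; rewrite lee_fin sqr_ge0.
have -> : e%:E = (2%:E * (e / 4)%:E + 2%:E * (e / 4)%:E)%E.
  by rewrite -!EFinM -EFinD; congr EFin; field.
by apply: leeD; apply: lee_wpmul2l.
Unshelve. all: by end_near. Qed.

Lemma rigid_function_cst c : rigid_function (fun=> c).
Proof.
split => //; rewrite (_ : (fun n => _) = cst 0%E); first exact: cvg_cst.
by apply/funext => n; rewrite integral0_eq// => x _; rewrite subrr expr0n.
Qed.

(** The increment of [r] is that of [s] plus two approximation errors, at [U n x] and at [x], of
    equal size by invariance. The square of a sum of three terms is at most 3 times the sum of the
    squares, hence the tolerance [e / 9]. *)
Lemma rigid_function_approx (r : X -> R) : measurable_fun setT r ->
  (forall e : R, 0 < e -> exists2 s, rigid_function s &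
     (\int[mu]_x ((r x - s x) ^+ 2)%:E <= e%:E)%E) ->
  rigid_function r.
Proof.
move=> mr h; split => //; apply/ge0_cvge0P => [n|e e0].
  by apply: integral_ge0 => x _; rewrite lee_fin sqr_ge0.
have e9 : 0 < e / 9 by rewrite divr_gt0.
have [s [ms rs] rse] := h _ e9.
have mrs : measurable_fun setT (fun x => ((r x - s x) ^+ 2)%:E).
  by apply/measurable_EFinP/measurable_funX/measurable_funB.
have rs0 x : (0 <= ((r x - s x) ^+ 2)%:E)%E by rewrite lee_fin sqr_ge0.
near=> n.
have msn := msq n ms.
have hs : (\int[mu]_x ((s (U n x) - s x) ^+ 2)%:E <= (e / 9)%:E)%E.
  by near: n; move/ge0_cvge0P : rs; exact.
have hU : (\int[mu]_x ((r (U n x) - s (U n x)) ^+ 2)%:E <= (e / 9)%:E)%E.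
  by rewrite (ge0_integral_measure_preserving (f := fun x => ((r x - s x) ^+ 2)%:E)
    (pU n)).
apply: (@le_trans _ _ (\int[mu]_x (3%:E * (((r (U n x) - s (U n x)) ^+ 2)%:E +
    (((s (U n x) - s x) ^+ 2)%:E + ((r x - s x) ^+ 2)%:E))))%E).
  apply: ge0_le_integral => //.
  - by move=> x _; rewrite lee_fin sqr_ge0.
  - exact: (msq n mr).
  - apply: measurable_funeM; apply: emeasurable_funD.
      by apply: (measurableT_comp mrs); case: (pU n).
    by apply: emeasurable_funD.
  move=> x _; rewrite -!EFinD -EFinM lee_fin.
  move: (r (U n x)) (s (U n x)) (r x) (s x) => a b c f.
  have := sqr_ge0 ((a - b) - (b - f)); have := sqr_ge0 ((a - b) + (c - f)).
  have := sqr_ge0 ((b - f) + (c - f)); nra.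
have mrsU : measurable_fun setT (fun x => ((r (U n x) - s (U n x)) ^+ 2)%:E).
  by apply: (measurableT_comp mrs); case: (pU n).
have mD : measurable_fun setT (fun x => (((s (U n x) - s x) ^+ 2)%:E + ((r x - s x) ^+ 2)%:E)%E).
  by apply: emeasurable_funD.
rewrite ge0_integralZl_EFin//; last 2 first.
- by move=> x _; rewrite -!EFinD lee_fin !addr_ge0// sqr_ge0.
- exact: emeasurable_funD.
rewrite ge0_integralD//; try by move=> x _; rewrite -?EFinD lee_fin ?addr_ge0// sqr_ge0.
rewrite ge0_integralD//; try by move=> x _; rewrite lee_fin sqr_ge0.
have -> : e%:E = (3%:E * ((e / 9)%:E + ((e / 9)%:E + (e / 9)%:E)))%E.
  by rewrite -!EFinD -!EFinM; congr EFin; field.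
by apply: lee_wpmul2l => //; apply: leeD => //; apply: leeD.
Unshelve. all: by end_near. Qed.

(** This serves for unions of rigid sets. In each of the four orderings, the increment of the
    maximum is bounded by one of the two increments, hence its square by the sum of their
    squares. *)
Lemma rigid_function_max s t : rigid_function s -> rigid_function t ->
  rigid_function (fun x => Num.max (s x) (t x)).
Proof.
move=> [ms rs] [mt rt]; split; first exact: measurable_maxr.
apply/ge0_cvge0P => [n|e e0].
  by apply: integral_ge0 => x _; rewrite lee_fin sqr_ge0.
have e2 : 0 < e / 2 by rewrite divr_gt0.
near=> n.
have msn := msq n ms.
have hs : (\int[mu]_x ((s (U n x) - s x) ^+ 2)%:E <= (e / 2)%:E)%E.
  by near: n; move/ge0_cvge0P : rs; exact.
have mtn := msq n mt.
have ht : (\int[mu]_x ((t (U n x) - t x) ^+ 2)%:E <= (e / 2)%:E)%E.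
  by near: n; move/ge0_cvge0P : rt; exact.
apply: (@le_trans _ _ (\int[mu]_x (((s (U n x) - s x) ^+ 2)%:E +
    ((t (U n x) - t x) ^+ 2)%:E))%E).
  apply: ge0_le_integral => //.
  - by move=> x _; rewrite lee_fin sqr_ge0.
  - exact: (msq n (measurable_maxr ms mt)).
  - by apply: emeasurable_funD.
  move=> x _; rewrite -EFinD lee_fin.
  move: (s (U n x)) (s x) (t (U n x)) (t x) => a a' b b'.
  have ha := sqr_ge0 (a - a'); have hb := sqr_ge0 (b - b').
  have sq_le (u v : R) : 0 <= u <= v \/ v <= u <= 0 -> u ^+ 2 <= v ^+ 2.
    by case=> /andP[? ?]; nra.
  case: (leP a b) => ab; case: (leP a' b') => ab'.
  - by rewrite lerDr.
  - case: (leP b a') => ba; [apply: ler_wpDr => //|apply: ler_wpDl => //]; apply: sq_le.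
      by right; lra.
    by left; lra.
  - case: (leP a b') => ba; [apply: ler_wpDl => //|apply: ler_wpDr => //]; apply: sq_le.
      by right; lra.
    by left; lra.
  - by rewrite lerDl.
rewrite ge0_integralD//; try by move=> x _; rewrite lee_fin sqr_ge0.
by rewrite [e in leRHS]splitr EFinD; exact: leeD.
Unshelve. all: by end_near. Qed.

Lemma rigid_sets_sigma_algebra : sigma_algebra setT rigid_sets.
Proof.
have rU A B : rigid_sets A -> rigid_sets B -> rigid_sets (A `|` B).
  move=> [mA rA] [mB rB]; split; first exact: measurableU.
  rewrite (_ : \1_(A `|` B) = fun x => Num.max (\1_A x) (\1_B x) :> R).
    exact: rigid_function_max.
  apply/funext => x; rewrite !indicE in_setU.
  by case: (x \in A); case: (x \in B); rewrite /= ?maxxx// /Num.max ?ltr01 ?ltr10.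
have r0 : rigid_sets set0.
  by split => //; rewrite indic0; exact: rigid_function_cst.
split => //.
- move=> A [mA rA]; rewrite setTD; split; first exact: measurableC.
  rewrite (_ : \1_(~` A) = fun x => 1 + (-1) * \1_A x :> R).
    apply: rigid_functionD; last exact: rigid_functionZ.
    exact: rigid_function_cst.
  by apply/funext => x; rewrite !indicE in_setC; case: (x \in A); rewrite /=; ring.
move=> A rA.
have mA n : measurable (A n) by case: (rA n).
have rAn n : rigid_sets (\big[setU/set0]_(i < n) A i).
  by elim/big_ind : _ => // i _; exact: rA.
have mAn n : measurable (\big[setU/set0]_(i < n) A i) by case: (rAn n).
have mUA : measurable (\bigcup_n A n) by exact: bigcupT_measurable.
split => //; apply: rigid_function_approx; first exact: measurable_indic.
move=> e e0.
(* The squared [L^2] distance between the indicators of the union and of its [n]-th partial union is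
   exactly [mu (E n)], which tends to 0 by continuity from above. *)
pose E n := (\bigcup_n A n) `\` \big[setU/set0]_(i < n) A i.
have mE n : measurable (E n) by exact: measurableD.
have : mu (E n) @[n --> \oo] --> mu (\bigcap_n E n).
  apply: nonincreasing_cvg_mu => //.
  - by rewrite -ge0_fin_numE// fin_num_measure.
  - exact: bigcapT_measurable.
  - move=> m n mn; apply/subsetPset; apply: setDS.
    by rewrite -!bigcup_mkord => x [i /= im Ax]; exists i => //=; exact: leq_trans mn.
have -> : \bigcap_n E n = set0.
  apply/seteqP; split => // x h; have [[n _ Anx] _] := h 0%N I.
  case: (h n.+1 I) => _; apply; rewrite -bigcup_mkord; exists n => //=.
rewrite measure0 => /ge0_cvge0P => /(_ (fun n => measure_ge0 mu (E n)) _ e0).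
case=> N _ /(_ N (leqnn N)) hN.
exists (\1_(\big[setU/set0]_(i < N) A i)); first by case: (rAn N).
apply: le_trans hN; rewrite -(setIT (E N)) -integral_indic//.
rewrite le_eqVlt; apply/orP; left; apply/eqP/eq_integral => x _; congr EFin.
rewrite !indicE in_setD.
have [a|a] := boolP (x \in \big[setU/set0]_(i < N) A i).
  have -> : x \in \bigcup_n A n.
    by move: a; rewrite !inE -bigcup_mkord => -[i _ ?]; exists i.
  by rewrite /= subrr expr0n.
by case: (x \in \bigcup_n A n); rewrite /= subr0 ?expr1n ?expr0n.
Qed.

Import HBNNSimple.

(** Such an [r] is an increasing limit of simple functions whose level sets are rigid, and [r ^+ 2]
    dominates the squared errors. *)
Lemma rigid_function_rigid_sets (r : X -> R) :
  (forall x, 0 <= r x) ->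
  measurable_fun setT (r : g_sigma_algebraType rigid_sets -> R) ->
  (\int[mu]_x ((r x) ^+ 2)%:E < +oo)%E ->
  rigid_function r.
Proof.
move=> r0 mr r2.
have Fm (A : set X) : (measurable : set (set (g_sigma_algebraType rigid_sets))) A -> rigid_sets A.
  by move=> h; have := sigma_algebra_id rigid_sets_sigma_algebra; rewrite /measurable /= => <-.
have mrX : measurable_fun setT r.
  move=> _ Y mY; have := mr measurableT Y mY; rewrite !setTI => /Fm.
  by case.
have mEr : measurable_fun setT (EFin \o r : g_sigma_algebraType rigid_sets -> \bar R).
  exact/measurable_EFinP.
pose g := nnsfun_approx measurableT mEr.
have mgX n : measurable_fun setT (fun x : X => g n x).
  move=> _ Y mY; have := @measurable_funP _ _ _ _ _ (g n) measurableT Y mY.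
  by rewrite !setTI => /Fm [].
have g0 n x : 0 <= g n x by [].
have gr n x : g n x <= r x.
  by rewrite -lee_fin nnsfun_approxE; apply: le_approx => //= y _; rewrite lee_fin.
have Er0 (y : g_sigma_algebraType rigid_sets) : setT y -> (0 <= (EFin \o r) y)%E.
  by rewrite lee_fin.
have cg x : g n x @[n --> \oo] --> r x.
  have /fine_cvgP[_] := @cvg_nnsfun_approx _ _ _ _ measurableT _ mEr Er0 x I.
  exact.
have rg n : rigid_function (fun x : X => g n x).
  rewrite (_ : (fun x : X => g n x) = fun x =>
      \sum_(y <- finmap.enum_fset (fset_set (range (g n)))) y * \1_(g n @^-1` [set y]) x); last first.
    by apply/funext => x; rewrite [LHS]fimfunE fsbig_finite//; exact: fimfunP.
  elim: (finmap.enum_fset _) => [|y ys ih].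
    under eq_fun do rewrite big_nil; exact: rigid_function_cst.
  under eq_fun do rewrite big_cons; apply: rigid_functionD => //.
  apply: rigid_functionZ; have [] // : rigid_sets (g n @^-1` [set y]).
  by apply: Fm; rewrite -[X in measurable X]setTI; exact: measurable_funP.
apply: rigid_function_approx => // e e0.
have mrg n : measurable_fun setT (fun x => ((r x - g n x) ^+ 2)%:E).
  by apply/measurable_EFinP/measurable_funX/measurable_funB.
have mr2 : measurable_fun setT (fun x => ((r x) ^+ 2)%:E).
  by apply/measurable_EFinP/measurable_funX.
have [//|//||||_ _] := @dominated_convergence _ _ _ mu setT measurableT
  (fun n x => ((r x - g n x) ^+ 2)%:E) (fun=> 0%E) (fun x => ((r x) ^+ 2)%:E).
- apply: aeW => x _; apply/fine_cvgP; split; first exact: nearW.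
  rewrite -[X in _ --> X](_ : (r x - r x) * (r x - r x) = 0); last by rewrite subrr mul0r.
  by apply: cvgM; apply: cvgB => //; exact: cvg_cst.
- apply/integrableP; split => //.
  by under eq_integral do rewrite gee0_abs ?lee_fin ?sqr_ge0//.
- apply: aeW => x n _; rewrite gee0_abs ?lee_fin ?sqr_ge0//.
  by have := gr n x; have := g0 n x; have := r0 x; nra.
rewrite integral0 => /ge0_cvge0P => /(_ _ _ e0)[|N _ /(_ N (leqnn N)) hN].
  by move=> n; apply: integral_ge0 => x _; rewrite lee_fin sqr_ge0.
by exists (g N).
Qed.

End Rigidity.

Lemma indic_preimage {R : pzRingType} {X Y} (V : X -> Y) (A : set Y) x :
  \1_(V @^-1` A) x = \1_A (V x) :> R.
Proof. by rewrite !indicE; congr (_ %:R); apply/idP/idP; rewrite !inE. Qed.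

Lemma normc_sqr {R : rcfType} (z : R[i]) :
  ComplexField.Normc.normc z ^+ 2 = complex.Re z ^+ 2 + complex.Im z ^+ 2.
Proof. by case: z => a b /=; rewrite sqr_sqrtr// addr_ge0// sqr_ge0. Qed.

Lemma sqnorm2E {R : realType} {d} {X : measurableType d}
    (mu : {measure set X -> \bar R}) (f : X -> R[i]) :
  sqnorm2 mu f =
  (\int[mu]_x (complex.Re (f x) ^+ 2 + complex.Im (f x) ^+ 2)%:E)%E.
Proof. by apply: eq_integral => x _; rewrite normc_sqr. Qed.

Section MildMixing.
Context {R : realType} {d} {X : measurableType d}.
Variables (mu : probability X R) (T : X -> X) (q : nat -> nat).

(** [T] commutes with its iterates and preserves [mu], so pulling a set back by [T] or by its
    inverse does not change the integrals that measure its rigidity. *)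
Lemma rigid_sets_factor : automorphism mu T ->
  Defs.factor mu T (rigid_sets mu (fun n => iter (q n) T)).
Proof.
move=> [pT [T' [pT' T'T TT']]].
have pU n : measure_preserving mu (iter (q n) T) by exact: measure_preserving_iter.
have mind (A : set X) : measurable A -> measurable_fun setT (\1_A : X -> R).
  by move=> mA; exact: measurable_indic.
have mpre V (A : set X) : measure_preserving mu V -> measurable A -> measurable (V @^-1` A).
  by move=> [mV _] mA; rewrite -[X in measurable X]setTI; exact: mV.
have mdiff V W (A : set X) : measurable A ->
    measure_preserving mu V -> measure_preserving mu W ->
    measurable_fun setT (fun x => ((\1_A (V x) - \1_A (W x) : R) ^+ 2)%:E).
  move=> mA [mV _] [mW _]; apply/measurable_EFinP/measurable_funX/measurable_funB.
    by apply: (measurableT_comp (mind _ mA)).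
  by apply: (measurableT_comp (mind _ mA)).
split.
- exact: rigid_sets_sigma_algebra.
- by move=> A [].
- move=> A [mA [_ rA]]; exists (T @^-1` A); last by rewrite setYK measure0.
  split; first exact: mpre.
  split; first exact/mind/mpre.
  apply: cvg_trans rA; apply: near_eq_cvg; apply: nearW => n.
  pose D x : \bar R := ((\1_A (iter (q n) T x) - \1_A x) ^+ 2)%:E.
  transitivity (\int[mu]_x D x)%E; first by [].
  rewrite -(ge0_integral_measure_preserving (f := D) pT); last 2 first.
  + exact: (mdiff _ id A mA (pU n) (measure_preserving_id mu)).
  + by move=> x; rewrite lee_fin sqr_ge0.
  by apply: eq_integral => x _; rewrite /D -iterSr !indic_preimage.
- move=> A [mA [_ rA]]; exists (T' @^-1` A); last first.
    apply: measure_negligible.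
      have mB : measurable (T @^-1` (T' @^-1` A)) by apply: (mpre _ _ pT); exact: mpre.
      by apply: measurableU; apply: measurableD.
    apply: negligibleS T'T => x /= h e; move: h; rewrite /setY /= e; tauto.
  split; first exact: mpre.
  split; first exact/mind/mpre.
  apply: cvg_trans rA; apply: near_eq_cvg; apply: nearW => n.
  (* [T'] commutes with the iterates only almost everywhere. Composing with [T] first makes both
     cancellations, at [x] and at [iter (q n) T x], instances of [T' (T x) = x]. *)
  pose D x : \bar R := ((\1_A (T' (iter (q n) T x)) - \1_A (T' x)) ^+ 2)%:E.
  transitivity (\int[mu]_x D x)%E; last by [].
  rewrite -(ge0_integral_measure_preserving (f := D) pT); last 2 first.
  + exact: (mdiff _ T' A mA (measure_preserving_comp pT' (pU n)) pT').
  + by move=> x; rewrite lee_fin sqr_ge0.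
  apply: ge0_ae_eq_integral => //.
  + exact: (mdiff _ id A mA (pU n) (measure_preserving_id mu)).
  + exact: (mdiff (T' \o iter (q n) T \o T) (T' \o T) A mA (measure_preserving_comp
      (measure_preserving_comp pT' (pU n)) pT) (measure_preserving_comp pT' pT)).
  + by move=> x _; rewrite lee_fin sqr_ge0.
  + by move=> x _; rewrite lee_fin sqr_ge0.
  have := ae_measure_preserving (pU n) T'T.
  apply: filterS2 T'T => x e1 e2 _.
  by rewrite /D -iterSr !indic_preimage iterS e1 e2.
Qed.

(** Approximation by simple functions gives rigidity for nonnegative functions, so [f] is cut into
    the positive and negative parts of its real and imaginary components. *)
Lemma rigid_sets_rigid_on : automorphism mu T -> q n @[n --> \oo] --> \oo ->
  rigid_on mu T (rigid_sets mu (fun n => iter (q n) T)).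
Proof.
move=> [pT _] qoo; exists q; split => // f [_ f2] [mRe mIm].
have pU n : measure_preserving mu (iter (q n) T) by exact: measure_preserving_iter.
set F := rigid_sets _ _ in mRe mIm.
have toX (r : X -> R) : measurable_fun setT (r : g_sigma_algebraType F -> R) ->
    measurable_fun setT r.
  move=> mr _ Y mY; have := mr measurableT Y mY; rewrite !setTI => h.
  have := sigma_algebra_id (rigid_sets_sigma_algebra pU); rewrite -/F => FE.
  by move: h; rewrite /measurable /= FE => -[].
have nneg (r : X -> R) : measurable_fun setT (r : g_sigma_algebraType F -> R) ->
    (\int[mu]_x ((r x) ^+ 2)%:E < +oo)%E ->
    rigid_function mu (fun n => iter (q n) T) (fun x => Num.max (r x) 0).
  move=> mr r2; apply: rigid_function_rigid_sets => //.
  - by move=> x; rewrite le_max lexx orbT.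
  - by apply: measurable_maxr => //; exact: measurable_cst.
  apply: le_lt_trans r2; apply: ge0_le_integral => //.
  - by move=> x _; rewrite lee_fin sqr_ge0.
  - apply/measurable_EFinP/measurable_funX/measurable_maxr; last exact: measurable_cst.
    exact: toX.
  - by apply/measurable_EFinP/measurable_funX; exact: toX.
  by move=> x _; rewrite lee_fin; case: (leP (r x) 0) => ?; nra.
have real_part (r : X -> R) : measurable_fun setT (r : g_sigma_algebraType F -> R) ->
    (\int[mu]_x ((r x) ^+ 2)%:E < +oo)%E ->
    rigid_function mu (fun n => iter (q n) T) r.
  move=> mr r2.
  rewrite (_ : r = fun x => Num.max (r x) 0 + (-1) * Num.max (- r x) 0); last first.
    by apply/funext => x; case: (leP (r x) 0) => ?; case: (leP (- r x) 0) => ?; lra.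
  apply: rigid_functionD => //; first exact: nneg.
  apply: rigid_functionZ => //; apply: nneg.
    exact: measurable_funN.
  by under eq_integral do rewrite sqrrN.
have f2E := sqnorm2E mu f; rewrite f2E in f2.
have mRe2 : measurable_fun setT (fun x => ((complex.Re (f x)) ^+ 2)%:E).
  by apply/measurable_EFinP/measurable_funX; exact: toX.
have mIm2 : measurable_fun setT (fun x => ((complex.Im (f x)) ^+ 2)%:E).
  by apply/measurable_EFinP/measurable_funX; exact: toX.
have Re2 : (\int[mu]_x ((complex.Re (f x)) ^+ 2)%:E < +oo)%E.
  apply: le_lt_trans f2; apply: ge0_le_integral => //.
  - by move=> x _; rewrite lee_fin sqr_ge0.
  - by under eq_fun do rewrite EFinD; exact: emeasurable_funD.
  - by move=> x _; rewrite lee_fin lerDl sqr_ge0.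
have Im2 : (\int[mu]_x ((complex.Im (f x)) ^+ 2)%:E < +oo)%E.
  apply: le_lt_trans f2; apply: ge0_le_integral => //.
  - by move=> x _; rewrite lee_fin sqr_ge0.
  - by under eq_fun do rewrite EFinD; exact: emeasurable_funD.
  - by move=> x _; rewrite lee_fin lerDr sqr_ge0.
have [mRe' rRe] := real_part _ mRe Re2.
have [mIm' rIm] := real_part _ mIm Im2.
have sqn n : sqnorm2 mu (fun x => f (iter (q n) T x) - f x) =
   (\int[mu]_x ((complex.Re (f (iter (q n) T x)) - complex.Re (f x)) ^+ 2)%:E +
    \int[mu]_x ((complex.Im (f (iter (q n) T x)) - complex.Im (f x)) ^+ 2)%:E)%E.
  have mU : measurable_fun setT (iter (q n) T) by case: (pU n).
  rewrite sqnorm2E -ge0_integralD//; last 4 first.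
  - by move=> x _; rewrite lee_fin sqr_ge0.
  - apply/measurable_EFinP/measurable_funX/measurable_funB => //.
    exact: (measurableT_comp mRe').
  - by move=> x _; rewrite lee_fin sqr_ge0.
  - apply/measurable_EFinP/measurable_funX/measurable_funB => //.
    exact: (measurableT_comp mIm').
  by apply: eq_integral => x _; rewrite -EFinD; case: (f (iter _ _ _)) => ? ?; case: (f x).
under eq_fun do rewrite sqn.
have := cvgeD (isT : (0 +? 0)%E) rRe rIm; rewrite adde0; apply.
Qed.

(** The sublevel sets of [u] are rigid along [q], so mild mixing gives them measure 0 or 1 and the
    law of [u] is a point mass. Passing through sets allows an unbounded [u] with no
    integrability. *)
Lemma mildly_mixing_rigid_function (u : X -> R) : mildly_mixing mu T ->
  q n @[n --> \oo] --> \oo -> measurable_fun setT u ->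
  {ae mu, forall x, u (iter (q n) T x) @[n --> \oo] --> u x} ->
  exists c, {ae mu, forall x, u x = c}.
Proof.
move=> [aT mm] qoo mu_ cu.
have pU n : measure_preserving mu (iter (q n) T).
  by apply: measure_preserving_iter; case: aT.
have mA t : measurable [set x | u x <= t].
  by rewrite -[X in measurable X]setTI; exact: measurable_fun_le.
have triv t : mu [set x | u x <= t] = 0%E \/ mu (~` [set x | u x <= t]) = 0%E.
  apply: (mm _ (rigid_sets_factor aT) (rigid_sets_rigid_on aT qoo)).
  split => //; split; first exact: measurable_indic.
  set A := [set x | u x <= t].
  pose a : X -> R := \1_A.
  have ba : bounded_measurable a by apply: bounded_measurable_indic; exact: mA.
  have bU n : bounded_measurable (a \o iter (q n) T).
    by apply: bounded_measurable_comp => //; case: (pU n).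
  have bD n : bounded_measurable (fun x => 2 * ((1 - a x) * a (iter (q n) T x))).
    exact: (bounded_measurableZ 2 (bounded_measurableM
      (bounded_measurableB (bounded_measurable_cst 1) ba) (bU n))).
  (* Both halves of the symmetric difference of [A] and its preimage have the
     same measure, so it suffices to control the points with [u > t], where
     convergence is harmless even if [t] is an atom of the law of [u]. *)
  have sqE k : (\int[mu]_x (((\1_A : X -> R) (iter (q k) T x) - (\1_A : X -> R) x) ^+ 2)%:E =
      \int[mu]_x (2 * ((1 - a x) * a (iter (q k) T x)))%:E)%E.
    transitivity (\int[mu]_x (2 * ((1 - a x) * a (iter (q k) T x)) + (a x - a (iter (q k) T x)))%:E)%E.
      apply: eq_integral => x _; congr EFin; rewrite /a !indicE.
      by case: (_ \in A); case: (_ \in A) => /=; ring.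
    have bB := bounded_measurableB ba (bU k).
    rewrite -!EFin_Rintegral//; last exact: (bounded_measurableD (bD k) bB).
    have iD := bounded_measurable_integrable mu (bD k).
    have iB := bounded_measurable_integrable mu bB.
    have ia := bounded_measurable_integrable mu ba.
    have iU := bounded_measurable_integrable mu (bU k).
    rewrite (RintegralD measurableT iD iB) (RintegralB measurableT ia iU) /=.
    by rewrite (Rintegral_measure_preserving (pU k))// ?subrr ?addr0//; case: ba.
  under eq_fun => k do rewrite sqE.
  have [//|//||||_ _] := @dominated_convergence _ _ _ mu setT measurableT
    (fun n x => (2 * ((1 - a x) * a (iter (q n) T x)))%:E) (fun=> 0%E) (cst 2%:E).
  - by move=> n; apply/measurable_EFinP; case: (bD n).
  - apply: filterS cu => x cx _; rewrite /a indicE.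
    have [xA|xA] := boolP (x \in A).
      by under eq_fun do rewrite subrr mul0r mulr0; exact: cvg_cst.
    apply: cvg_near_cst; move: xA; rewrite notin_setE /A /= => /negP; rewrite -ltNge => tu.
    have : \forall n \near \oo, t < u (iter (q n) T x) by apply: cvgr_gt tu.
    apply: filterS => n tun; rewrite indicE memNset ?mulr0 ?mulr0//=.
    by rewrite leNgt tun.
  - exact: finite_measure_integrable_cst.
  - apply: aeW => x n _; rewrite lee_fin /a !indicE.
    by case: (_ \in A); case: (_ \in A); rewrite /= ?subrr ?subr0 ?mulr0 ?mul0r ?mulr1 ?normr0 ?mulr0 ?normr0// ger0_norm.
  by rewrite integral0.
have muT : mu setT = 1%E by exact: probability_setT.
have aeF (P : X -> Prop) : (forall x, ~ P x) -> {ae mu, forall x, P x} -> False.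
  move=> nP [N [mN N0 PN]]; have : mu setT = 0%E.
    by apply: measure_negligible => //; exists N; split => // x _; apply: PN => /=.
  by rewrite muT => /eqP; rewrite onee_eq0.
have ae_gt t : mu [set x | u x <= t] = 0%E -> {ae mu, forall x, t < u x}.
  move=> h; exists [set x | u x <= t]; split => // x /= /negP; by rewrite -leNgt.
have ae_le t : mu (~` [set x | u x <= t]) = 0%E -> {ae mu, forall x, u x <= t}.
  by move=> h; exists (~` [set x | u x <= t]); split => //; exact: measurableC.
(* The distribution function of [u] takes only the values 0 and 1, and the constant is the place of
   its jump. If [S] were empty or unbounded above, [u] would almost surely lie below every [- n%:R]
   or above every [n%:R]. *)
pose S := [set t | mu [set x | u x <= t] = 0%E].
have hS : has_sup S.
  split.
    apply: contrapT => nS.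
    apply: (aeF (fun x => forall n, u x <= - n%:R)).
      move=> x h; have := h (Num.truncn `|u x|).+1; have := truncnS_gt `|u x|.
      by have := ler_norm (- u x); rewrite normrN; lra.
    apply: ae_foralln => n; apply: ae_le; have [h|//] := triv (- n%:R).
    by exfalso; apply: nS; exists (- n%:R).
  apply: contrapT => nS.
  apply: (aeF (fun x => forall n, n%:R < u x)).
    move=> x h; have := h (Num.truncn `|u x|).+1; have := truncnS_gt `|u x|.
    by have := ler_norm (u x); lra.
  apply: ae_foralln => n; apply: contrapT => h; apply: nS; exists n%:R => t tS.
  rewrite leNgt; apply/negP => nt; apply: h.
  by apply: filterS (ae_gt _ tS) => x; apply: lt_trans.
exists (sup S).
have h1 n : {ae mu, forall x, sup S - n.+1%:R^-1 < u x}.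
  have n0 : 0 < (n.+1%:R : R)^-1 by rewrite invr_gt0.
  have [t tS tlt] := sup_adherent n0 hS.
  by apply: filterS (ae_gt _ tS) => x; apply: lt_trans.
have h2 n : {ae mu, forall x, u x <= sup S + n.+1%:R^-1}.
  apply: ae_le; have [h|//] := triv (sup S + n.+1%:R^-1).
  have := ub_le_sup hS.2 h; have : 0 < (n.+1%:R : R)^-1 by rewrite invr_gt0.
  by rewrite gerDl leNgt => ->.
apply: filterS2 (ae_foralln h1) (ae_foralln h2) => x a b.
apply/eqP; rewrite eq_le; apply/andP; split.
  apply/ler_addgt0Pr => e e0; near \oo => n.
  apply: (le_trans (b n)); rewrite lerD2l ltW//; near: n; exact: near_infty_natSinv_lt (PosNum e0).
apply/ler_addgt0Pr => e e0; near \oo => n.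
rewrite -lerBlDr (le_trans _ (ltW (a n)))// lerB// ltW//; near: n.
exact: near_infty_natSinv_lt (PosNum e0).
Unshelve. all: by end_near. Qed.

End MildMixing.

(** * Characters *)

Lemma second_countable_enum {T : topologicalType} : @second_countable T ->
  exists B : nat -> set T, (forall n, open (B n)) /\
    forall (O : set T) x, open O -> O x -> exists2 n, B n x & B n `<=` O.
Proof.
move=> [B /countable_injP[f finj] [Bo Bb]].
(* Numbers that code no basic set are sent to the empty set, which is open and does no harm. *)
pose E n := xget set0 [set U | B U /\ f U = n].
exists E; split=> [n|O x oO Ox].
  by rewrite /E; case: xgetP => [U _ [/Bo]|_] //; exact: open0.
have [U [BU Ux] UO] : filter_from [set U | B U /\ U x] id O.
  by apply: Bb; exact: open_nbhs_nbhs.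
have EU : E (f U) = U.
  rewrite /E; case: xgetP => [V _ [BV]|/(_ U)]; last by case.
  by apply: finj; exact/mem_set.
by exists (f U); rewrite EU.
Qed.

Lemma measurable_fun_gt {R : realType} {d} {X : measurableType d} (f : X -> R) :
  (forall a, measurable [set x | a < f x]) -> measurable_fun setT f.
Proof.
move=> mf _; apply: (measurability _ (RGenOInfty.measurableE R)) => //.
move=> _ [_ [a ->] <-]; rewrite setTI.
rewrite (_ : _ @^-1` _ = [set x | a < f x]); first exact: mf.
by apply/seteqP; split => x /=; rewrite in_itv /= andbT.
Qed.

Lemma continuous_measurable_borel {R : realType} {T : ptopologicalType} (f : T -> R) :
  continuous f -> measurable_fun setT (f : borel T -> R).
Proof.
move=> cf; apply: measurable_fun_gt => a; apply: sub_sigma_algebra.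
rewrite (_ : [set x | _] = f @^-1` `]a, +oo[).
  by apply: (continuousP _).1 => //; exact: interval_open.
by apply/seteqP; split => x /=; rewrite in_itv /= andbT.
Qed.

(* Caratheodory functions are jointly measurable: if [f x w > a] then [f y w]
   is at least some [r > a] for all [y] in a basic open set containing [x],
   and by continuity this only has to be tested on one point per basic set. *)
Lemma measurable_caratheodory {R : realType} {T : ptopologicalType} {d}
    {W : measurableType d} (f : T -> W -> R) : @second_countable T ->
  (forall w, continuous (f ^~ w)) -> (forall x, measurable_fun setT (f x)) ->
  measurable_fun setT (fun p : borel T * W => f p.1 p.2).
Proof.
move=> /second_countable_enum[B [Bo Bb]] cf mf; apply: measurable_fun_gt => a.
pose pt n := xget point (B n).
pose C n (k : nat) := [set w | forall m, B m `<=` B n -> B m !=set0 ->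
  a + k.+1%:R^-1 <= f (pt m) w].
have ptB m : B m !=set0 -> B m (pt m).
  by move=> [x Bx]; rewrite /pt; case: xgetP => // /(_ x).
have mC n k : measurable (C n k).
  rewrite (_ : C n k = \bigcap_(m in [set m | B m `<=` B n /\ B m !=set0])
      [set w | a + k.+1%:R^-1 <= f (pt m) w]); last first.
    apply/seteqP; split => w h m /=; first by case; exact: h.
    by move=> h1 h2; exact: h.
  apply: bigcap_measurableType => m _.
  rewrite -[X in measurable X]setTI.
  by apply: measurable_fun_le => //; exact: mf.
rewrite (_ : [set p | _] = \bigcup_n \bigcup_k (B n `*` C n k)).
  apply: bigcupT_measurable => n; apply: bigcupT_measurable => k.
  by apply: measurableX => //; apply: sub_sigma_algebra; exact: Bo.
apply/seteqP; split => [[x w] /= afx|[x w] [n _ [k _ [/= Bx Cw]]]].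
  near \oo => k.
  have ak : a + k.+1%:R^-1 < f x w.
    rewrite -ltrBrDl; near: k.
    have fa : 0 < f x w - a by rewrite subr_gt0.
    exact: near_infty_natSinv_lt (PosNum fa).
  have oO : open [set y | a + k.+1%:R^-1 < f y w].
    rewrite (_ : [set y | _] = (f ^~ w) @^-1` `]a + k.+1%:R^-1, +oo[).
      apply: (continuousP _).1; [exact: cf|exact: interval_open].
    by apply/seteqP; split => y /=; rewrite in_itv /= andbT.
  have [n Bx BO] := Bb _ x oO ak.
  exists n => //; exists k => //; split => //= m Bm Bm0.
  by apply: ltW; apply: BO; apply: Bm; exact: ptB.
(* If [f x w <= a], continuity gives a basic set around [x], inside [B n], on which [f] stays below
   [a + k.+1%:R^-1]; its sample point contradicts [C n k]. *)
rewrite ltNge; apply/negP => fa.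
have oO : open (B n `&` [set y | f y w < a + k.+1%:R^-1]).
  apply: openI; first exact: Bo.
  rewrite (_ : [set y | _] = (f ^~ w) @^-1` `]-oo, a + k.+1%:R^-1[).
    apply: (continuousP _).1; [exact: cf|exact: interval_open].
  by apply/seteqP; split => y /=; rewrite in_itv.
have [|m Bx' BO] := Bb _ x oO.
  by split => //=; rewrite (le_lt_trans fa)// ltrDl invr_gt0.
have m0 : B m !=set0 by exists x.
have := Cw m (fun y By => (BO y By).1) m0.
by have [_ /=] := BO _ (ptB _ m0); rewrite ltNge => /negP.
Unshelve. all: by end_near. Qed.

Section Characters.
Context {R : realType} {G : topologicalZmodType}.
Implicit Types (chi : dual R G) (g h : G).

Let charP chi : characters (set_val (chi : set_type (@characters R G))).
Proof. by apply: set_mem; exact: valP. Qed.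

Lemma continuous_character chi : continuous (character chi : G -> (R[i])^o).
Proof. by case: (charP chi). Qed.

Lemma norm_character chi g : `|character chi g| = 1.
Proof. by have [_ h _] := charP chi; exact: h. Qed.

Lemma characterD chi g h : character chi (g + h) = character chi g * character chi h.
Proof. by have [_ _ h'] := charP chi; exact: h'. Qed.

Lemma continuous_Re : continuous (@complex.Re R : (R[i])^o -> R).
Proof.
move=> z A /nbhs_ballP[e /= e0 eA]; apply/nbhs_ballP.
exists (e%:C)%C; first by rewrite /= ltcR.
move=> w h; apply: eA; move: h; rewrite /ball /= => h; rewrite -(ltcR (R := R)); apply: le_lt_trans h.
by case: z w => a b [c f]; exact: (normc_ge_Re ((a +i* b)%C - (c +i* f)%C)).
Qed.

Lemma continuous_Im : continuous (@complex.Im R : (R[i])^o -> R).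
Proof.
move=> z A /nbhs_ballP[e /= e0 eA]; apply/nbhs_ballP.
exists (e%:C)%C; first by rewrite /= ltcR.
move=> w h; apply: eA; move: h; rewrite /ball /= => h; rewrite -(ltcR (R := R)); apply: le_lt_trans h.
case: z w => a b [c f]; have := normc_ge_Re (((a +i* b)%C - (c +i* f)%C) * 'i%C).
rewrite ReiNIm normrN normrM (_ : `|'i%C| = 1 :> R[i]) ?mulr1//.
by rewrite normc_def /= expr0n expr1n add0r sqrtr1.
Qed.

(** A single point is compact, so evaluation at it pulls open sets back to subbasic sets of the
    compact-open topology. *)
Lemma continuous_evaluation g : continuous ((character (R := R) (G := G))^~ g : dual R G -> (R[i])^o).
Proof.
pose ev (f : {compact-open, G -> (R[i])^o}) : (R[i])^o := f g.
have cev : continuous ev.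
  apply/continuousP => O oO.
  rewrite (_ : ev @^-1` O = [set f | f @` [set g] `<=` O]).
    by apply: compact_open_open => //; exact: compact_set1.
  apply/seteqP; split => f /=; first by move=> fO _ [_ -> <-].
  by move=> h; apply: h; exists g.
move=> chi; apply: (@continuous_comp _ _ _ set_val ev); last exact: cev.
exact: initial_continuous.
Qed.


Lemma continuous_Re_character chi :
  continuous ((fun g => complex.Re (character chi g)) : G -> R).
Proof.
move=> g; apply: (@continuous_comp _ _ _ (character chi : G -> (R[i])^o)).
  exact: continuous_character.
exact: continuous_Re.
Qed.

Lemma continuous_Im_character chi :
  continuous ((fun g => complex.Im (character chi g)) : G -> R).
Proof.
move=> g; apply: (@continuous_comp _ _ _ (character chi : G -> (R[i])^o)).
  exact: continuous_character.
exact: continuous_Im.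
Qed.

Lemma measurable_Re_evaluation g :
  measurable_fun setT (fun chi : borel (dual R G) => complex.Re (character chi g)).
Proof.
apply: (@continuous_measurable_borel R (dual R G)) => chi.
apply: (@continuous_comp _ _ _ ((character (R := R) (G := G))^~ g : dual R G -> (R[i])^o)).
  exact: continuous_evaluation.
exact: continuous_Re.
Qed.

Lemma measurable_Im_evaluation g :
  measurable_fun setT (fun chi : borel (dual R G) => complex.Im (character chi g)).
Proof.
apply: (@continuous_measurable_borel R (dual R G)) => chi.
apply: (@continuous_comp _ _ _ ((character (R := R) (G := G))^~ g : dual R G -> (R[i])^o)).
  exact: continuous_evaluation.
exact: continuous_Im.
Qed.

(** The group variable plays the continuous role in the Caratheodory argument, so that the countable
    basis is taken in [G] and the dual enters through measurability alone. *)
Lemma measurable_character_Re : @second_countable G ->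
  measurable_fun setT (fun p : borel_group G * borel (dual R G) =>
    complex.Re (character p.2 p.1)).
Proof.
move=> G2; apply: (@measurable_caratheodory R (pointed_group G) _ (borel (dual R G))
    (fun g chi => complex.Re (character chi g))) => // [chi|g].
  exact: continuous_Re_character.
exact: measurable_Re_evaluation.
Qed.

Lemma measurable_character_Im : @second_countable G ->
  measurable_fun setT (fun p : borel_group G * borel (dual R G) =>
    complex.Im (character p.2 p.1)).
Proof.
move=> G2; apply: (@measurable_caratheodory R (pointed_group G) _ (borel (dual R G))
    (fun g chi => complex.Im (character chi g))) => // [chi|g].
  exact: continuous_Im_character.
exact: measurable_Im_evaluation.
Qed.

End Characters.

(** * Rigid unimodular cocycles *)

Section ComplexSequences.
Context {R : realType}.
Implicit Types (u v : nat -> R[i]) (a b : R[i]).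

(** Convergence is componentwise, in agreement with [measurableC] and [integralC], so that the real
    limit lemmas apply directly. *)
Definition cvgC u a :=
  complex.Re (u n) @[n --> \oo] --> complex.Re a /\
  complex.Im (u n) @[n --> \oo] --> complex.Im a.

Lemma complex_ReM a b : complex.Re (a * b) =
  complex.Re a * complex.Re b - complex.Im a * complex.Im b.
Proof. by case: a b => ? ? [? ?]. Qed.

Lemma complex_ImM a b : complex.Im (a * b) =
  complex.Re a * complex.Im b + complex.Im a * complex.Re b.
Proof. by case: a b => ? ? [? ?]. Qed.

Lemma cvgC_cst a : cvgC (fun=> a) a.
Proof. by split; exact: cvg_cst. Qed.

Lemma cvgCM u v a b : cvgC u a -> cvgC v b -> cvgC (fun n => u n * v n) (a * b).
Proof.
move=> [ua ua'] [vb vb']; split.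
  rewrite complex_ReM; under eq_fun do rewrite complex_ReM.
  by apply: cvgB; apply: cvgM.
rewrite complex_ImM; under eq_fun do rewrite complex_ImM.
by apply: cvgD; apply: cvgM.
Qed.

Lemma cvgC_conj u a : cvgC u a -> cvgC (fun n => ((u n)^*)%C) (a^*)%C.
Proof.
have ReJ z : complex.Re (z^*)%C = complex.Re z :> R by case: z.
have ImJ z : complex.Im (z^*)%C = - complex.Im z :> R by case: z.
move=> [ua ua']; split.
  by rewrite ReJ; under eq_fun do rewrite ReJ.
by rewrite ImJ; under eq_fun do rewrite ImJ; exact: cvgN.
Qed.

Lemma mulJ_unit a : `|a| = 1 -> a * (a^*)%C = 1.
Proof. by move=> a1; rewrite -sqr_normc a1 expr1n. Qed.

Lemma normC_eq1 a : complex.Re a ^+ 2 + complex.Im a ^+ 2 = 1 -> `|a| = 1.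
Proof. by rewrite normc_def => ->; rewrite sqrtr1. Qed.

Lemma normC_sqr a : `|a| = 1 -> complex.Re a ^+ 2 + complex.Im a ^+ 2 = 1.
Proof. by move=> a1; have := add_Re2_Im2 a; rewrite a1 expr1n => -[]. Qed.

Lemma Re_unit_le1 a : `|a| = 1 -> `|complex.Re a| <= 1.
Proof.
move=> /normC_sqr h; rewrite -(expr_le1 (n := 2))// -normrX ger0_norm ?sqr_ge0//.
by rewrite -h lerDl sqr_ge0.
Qed.

Lemma Im_unit_le1 a : `|a| = 1 -> `|complex.Im a| <= 1.
Proof.
move=> /normC_sqr h; rewrite -(expr_le1 (n := 2))// -normrX ger0_norm ?sqr_ge0//.
by rewrite -h lerDr sqr_ge0.
Qed.

End ComplexSequences.

Section MeasurableC.
Context {R : realType} {d} {X : measurableType d}.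
Implicit Types f g : X -> R[i].

Lemma measurableCM f g : Defs.measurableC f -> Defs.measurableC g ->
  Defs.measurableC (fun x => f x * g x).
Proof.
move=> [f1 f2] [g1 g2]; split.
  by under eq_fun do rewrite complex_ReM; apply: measurable_funB; exact: measurable_funM.
by under eq_fun do rewrite complex_ImM; apply: measurable_funD; exact: measurable_funM.
Qed.

Lemma measurableC_conj f : Defs.measurableC f -> Defs.measurableC (fun x => ((f x)^*)%C).
Proof.
move=> [f1 f2]; split.
  by rewrite (_ : (fun x => _) = fun x => complex.Re (f x))//; apply/funext => x; case: (f x).
rewrite (_ : (fun x => _) = fun x => - complex.Im (f x)); first exact: measurable_funN.
by apply/funext => x; case: (f x).
Qed.

Lemma measurableC_comp {d'} {Y : measurableType d'} (g : Y -> X) f :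
  Defs.measurableC f -> measurable_fun setT g -> Defs.measurableC (fun y => f (g y)).
Proof. by move=> [f1 f2] mg; split; [exact: (measurableT_comp f1)|exact: (measurableT_comp f2)]. Qed.

End MeasurableC.

Section UnimodularCocycle.
Context {R : realType} {d} {X : measurableType d}.
Variables (mu : probability X R) (T : X -> X) (q : nat -> nat).

(* The modulus of [h] is rigid, hence constant. After normalising it to 1, the
   cocycle [psi = alpha * (h \o T) / h] has Birkhoff products over [q n] steps
   tending to 1; comparing those started at [x] and at [T x] shows that [psi]
   itself is rigid, hence constant. *)
Lemma rigid_unimodular_cocycle (alpha h : X -> R[i]) : mildly_mixing mu T ->
  q n @[n --> \oo] --> \oo -> Defs.measurableC alpha -> (forall x, `|alpha x| = 1) ->
  Defs.measurableC h ->
  {ae mu, forall x, cvgC (fun n =>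
     \prod_(i < q n) alpha (iter i T x) * h (iter (q n) T x)) (h x)} ->
  {ae mu, forall x, h x = 0} \/
  exists (c : R[i]) (xi : X -> R[i]), [/\ `|c| = 1, Defs.measurableC xi,
    (forall x, `|xi x| = 1) &
    {ae mu, forall x, alpha x = c * (xi x / xi (T x))}].
Proof.
move=> mm qoo malpha alpha1 mh ch.
have pT : measure_preserving mu T by case: mm => [[]].
have pTn n : measure_preserving mu (iter n T) by exact: measure_preserving_iter.
pose m x := complex.Re (h x) ^+ 2 + complex.Im (h x) ^+ 2.
have mmeas : measurable_fun setT m.
  by case: mh => ? ?; apply: measurable_funD; exact: measurable_funX.
have prod1 n x : `|\prod_(i < n) alpha (iter i T x)| = 1.
  by rewrite normr_prod big1.
have [c0 mc0] : exists c0, {ae mu, forall x, m x = c0}.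
  apply: (mildly_mixing_rigid_function mm qoo mmeas).
  apply: filterS ch => x [chr chi].
  have -> : (fun n => m (iter (q n) T x)) = fun n =>
     complex.Re (\prod_(i < q n) alpha (iter i T x) * h (iter (q n) T x)) ^+ 2 +
     complex.Im (\prod_(i < q n) alpha (iter i T x) * h (iter (q n) T x)) ^+ 2.
    apply/funext => n; have := add_Re2_Im2 (\prod_(i < q n) alpha (iter i T x) * h (iter (q n) T x)).
    by rewrite normrM prod1 mul1r -add_Re2_Im2 => -[].
  by apply: cvgD; rewrite expr2; under eq_fun do rewrite expr2; exact: cvgM.
have [c0E|c00] := eqVneq c0 0.
  rewrite c0E in mc0; left; apply: filterS mc0 => x; rewrite /m => /eqP.
  rewrite paddr_eq0 ?sqr_ge0// !sqrf_eq0 => /andP[/eqP h1 /eqP h2].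
  by apply/eqP; rewrite eq_complex h1 h2 !eqxx.
right.
pose E := [set x | m x = c0].
have mE : measurable E.
  by rewrite -[X in measurable X]setTI; exact: (mmeas measurableT [set c0]).
pose s := Num.sqrt c0.
(* [xi] must have modulus 1 at every point, hence the value 1 on the null set outside [E]. *)
pose xi x := if x \in E then h x * (s^-1)%:C%C else 1.
have xiE x : m x = c0 -> xi x = h x * (s^-1)%:C%C.
  by move=> mx; rewrite /xi mem_set.
have mxi : Defs.measurableC xi.
  split.
    rewrite (_ : (fun x => _) = fun x => complex.Re (h x) * s^-1 * \1_E x + \1_(~` E) x).
      apply: measurable_funD; last exact/measurable_indic/measurableC.
      apply: measurable_funM; last exact: measurable_indic.
      by apply: measurable_funM => //; case: mh.
    apply/funext => x; rewrite !indicE /xi in_setC; case: (x \in E) => /=.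
      by rewrite complex_ReM /=; ring.
    by ring.
  rewrite (_ : (fun x => _) = fun x => complex.Im (h x) * s^-1 * \1_E x).
    apply: measurable_funM; last exact: measurable_indic.
    by apply: measurable_funM => //; case: mh.
  apply/funext => x; rewrite !indicE /xi; case: (x \in E) => /=.
    by rewrite complex_ImM /=; ring.
  by ring.
have c0_gt0 (x : X) : m x = c0 -> 0 < c0.
  by move=> mx; rewrite lt_neqAle eq_sym c00 -mx addr_ge0// sqr_ge0.
have xi1 x : `|xi x| = 1.
  rewrite /xi; case: ifPn => [/set_mem xE|_]; last exact: normr1.
  have c0p := c0_gt0 _ xE.
  apply: normC_eq1; rewrite complex_ReM complex_ImM /= !mulr0 subr0 add0r !exprMn -mulrDl.
  by rewrite -/(m x) xE exprVn sqr_sqrtr ?ltW// divff.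
have m_iter : {ae mu, forall x, forall n, m (iter n T x) = c0}.
  by apply: ae_foralln => n; exact: (ae_measure_preserving (pTn n) mc0).
pose P n x := \prod_(i < n) alpha (iter i T x).
have cxi : {ae mu, forall x, cvgC (fun n => P (q n) x * xi (iter (q n) T x)) (xi x)}.
  apply: filterS2 ch m_iter => x cx mx.
  rewrite (xiE x (mx 0%N)); under eq_fun do rewrite (xiE _ (mx _)) mulrA.
  by apply: cvgCM => //; exact: cvgC_cst.
pose psi x := alpha x * xi (T x) * ((xi x)^*)%C.
have psi1 x : `|psi x| = 1 by rewrite /psi !normrM normcJ alpha1 !xi1 !mulr1.
have psiM n x : \prod_(i < n) psi (iter i T x) = P n x * xi (iter n T x) * ((xi x)^*)%C.
  rewrite /P; elim: n => [|n ih]; first by rewrite !big_ord0 mul1r mulJ_unit.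
  rewrite !big_ord_recr /= ih /psi -iterS.
  have := mulJ_unit (xi1 (iter n T x)); move: (xi (iter n T x)) => z zz.
  by rewrite -[RHS]mul1r -zz; ring.
(* The product of [psi] over the first [n.+1] points of the orbit is split at its last factor and at
   its first one; dividing by a number of modulus 1 is multiplying by its conjugate. *)
have psiS n x : psi (iter n T x) = psi x * \prod_(i < n) psi (iter i T (T x)) *
    ((\prod_(i < n) psi (iter i T x))^*)%C.
  have : psi (iter n T x) * \prod_(i < n) psi (iter i T x) =
     psi x * \prod_(i < n) psi (iter i T (T x)).
    rewrite mulrC -(big_ord_recr n (fun i : 'I_n.+1 => psi (iter i T x))) big_ord_recl /=.
    congr (_ * _).
    by apply: eq_bigr => i _; rewrite -iterSr.
  have p1 : `|\prod_(i < n) psi (iter i T x)| = 1 by rewrite normr_prod big1.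
  by move=> <-; rewrite -mulrA mulJ_unit// mulr1.
have cP : {ae mu, forall x, cvgC (fun n => \prod_(i < q n) psi (iter i T x)) 1}.
  apply: filterS cxi => x cx; under eq_fun do rewrite psiM.
  by rewrite -(mulJ_unit (xi1 x)); apply: cvgCM => //; exact: cvgC_cst.
have cpsi : {ae mu, forall x, cvgC (fun n => psi (iter (q n) T x)) (psi x)}.
  apply: filterS2 cP (ae_measure_preserving pT cP) => x cx cTx.
  under eq_fun do rewrite psiS.
  rewrite -[X in cvgC _ X]mulr1 -[X in cvgC _ (X * _)]mulr1 -[X in cvgC _ (_ * X)]conjc1.
  by apply: cvgCM; [apply: cvgCM => //; exact: cvgC_cst|exact: cvgC_conj].
have mpsi : Defs.measurableC psi.
  apply: measurableCM; last exact: measurableC_conj.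
  by apply: measurableCM => //; apply: measurableC_comp => //; case: pT.
have [a ha] : exists a, {ae mu, forall x, complex.Re (psi x) = a}.
  apply: (mildly_mixing_rigid_function mm qoo); first by case: mpsi.
  by apply: filterS cpsi => x [].
have [b hb] : exists b, {ae mu, forall x, complex.Im (psi x) = b}.
  apply: (mildly_mixing_rigid_function mm qoo); first by case: mpsi.
  by apply: filterS cpsi => x [].
have hc : {ae mu, forall x, psi x = (a +i* b)%C}.
  by apply: filterS2 ha hb => x <- <-; case: (psi x).
exists (a +i* b)%C, xi; split => //.
(* A property true almost everywhere for a probability holds at some point, and the modulus of the
   constant is read off there. *)
- have muT : (0 < mu setT)%E by rewrite probability_setT.
  have FF := ae_properfilter_algebraOfSetsType muT.
  by have [x <-] := filter_ex hc; exact: psi1.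
- apply: filterS hc => x <-; rewrite /psi.
  have z1 := mulJ_unit (xi1 x); have z2 : xi (T x) != 0 by rewrite -normr_eq0 xi1 oner_eq0.
  rewrite mulrA -[_ * xi x]mulrA [_ * xi x]mulrC z1 mulr1 mulfK//.
Qed.

End UnimodularCocycle.

(** * Rokhlin extensions *)

(** The complement of the diagonal is a countable union of rectangles over disjoint basic open sets.
    This makes equality of two measurable maps into [Y] a measurable condition, as needed to
    assemble fibrewise identities on a product. *)
Lemma standard_borel_measurable_diagonal {R : realType} {d} {Y : measurableType d} :
  standard_borel R Y -> measurable [set p : Y * Y | p.1 = p.2].
Proof.
move=> [P [hP P2 [f [g [mf mg fg gf]]]]].
have [B [Bo Bb]] := second_countable_enum P2.
have mB n : measurable (f @^-1` B n).
  by rewrite -[X in measurable X]setTI; apply: mf => //; exact: sub_sigma_algebra.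
rewrite -[X in measurable X]setCK; apply: measurableC.
rewrite (_ : ~` _ = \bigcup_(m in setT) \bigcup_(n in [set n | B m `&` B n = set0])
    ((f @^-1` B m) `*` (f @^-1` B n))).
  apply: bigcup_measurable => m _; apply: bigcup_measurable => n _.
  exact: measurableX.
apply/seteqP; split => [[y z] /= yz|[y z] /= [m _ [n mn [/= Bm Bn]]] yz]; last first.
  have : (B m `&` B n) (f y) by split => //; rewrite yz.
  by rewrite mn.
move: hP; rewrite open_hausdorff => /(_ (f y) (f z)) [|[U V] /= [/set_mem Uy /set_mem Vz] [oU oV /eqP UV]].
  by apply/eqP => /(can_inj fg).
have [m By BU] := Bb _ _ oU Uy; have [n Bz BV] := Bb _ _ oV Vz.
exists m => //; exists n => //=.
by rewrite -subset0 -UV; exact: setISS.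
Qed.

Lemma ae_fst {R : realType} {d1 d2} {X : measurableType d1} {Y : measurableType d2}
    (mu : probability X R) (nu : probability Y R) (P : X -> Prop) :
  {ae mu, forall x, P x} -> {ae (mu \x nu)%E, forall p, P p.1}.
Proof.
move=> [N [mN N0 PN]]; exists (N `*` setT); split.
- exact: measurableX.
- by rewrite product_measure1E//= [X in (X * _)%E](_ : _ = 0%E) ?mul0e.
- by move=> p /= nP; split => //; exact: PN.
Qed.

(** The section at [x] of the preimage of [A] is the preimage under [U x] of the section of [A] at
    [T x]. *)
Lemma measure_preserving_skew {R : realType} {d1 d2} {X : measurableType d1}
    {Y : measurableType d2} (mu : {measure set X -> \bar R})
    (nu : {sigma_finite_measure set Y -> \bar R}) (T : X -> X) (U : X -> Y -> Y) :
  measure_preserving mu T -> (forall x, measure_preserving nu (U x)) ->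
  measurable_fun setT (fun p : X * Y => U p.1 p.2) ->
  measure_preserving (mu \x nu)%E (fun p => (T p.1, U p.1 p.2)).
Proof.
move=> pT pU mU.
have mTU : measurable_fun setT (fun p : X * Y => (T p.1, U p.1 p.2)).
  by apply/measurable_fun_pair => //=; apply: measurableT_comp => //; case: pT.
split => // A mA.
have := ge0_integral_measure_preserving pT (measurable_fun_xsection nu mA)
  (fun x => measure_ge0 nu _).
apply: etrans; apply: eq_integral => x _ /=.
rewrite -[RHS](pU x).2; last exact: measurable_xsection.
by congr (nu _); apply/seteqP; split => y /= /xsectionP h; apply/xsectionP.
Qed.

Section RokhlinExtension.
Context {R : realType} {dX} {X : measurableType dX} {dY} {Y : measurableType dY}.
Context {G : topologicalZmodType}.
Variables (mu : probability X R) (nu : probability Y R).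
Variables (T : X -> X) (phi : X -> borel_group G) (S : G -> Y -> Y).
Hypotheses (mphi : measurable_fun setT phi) (aS : measurable_action nu S).

Lemma measure_preserving_action g : measure_preserving nu (S g).
Proof. by case: aS => _ /(_ g) []. Qed.

(** The homomorphism property holds modulo null sets only: it makes [S 0] idempotent almost
    everywhere, and the almost everywhere inverse of [S 0] cancels one factor. *)
Lemma action0 : {ae nu, forall y, S 0 y = y}.
Proof.
have [_ /(_ 0) [pS0 [S' [_ S'S _]]] /(_ 0 0)] := aS; rewrite addr0 => h.
have h' := ae_measure_preserving pS0 S'S.
apply: filterS3 h S'S h' => y e1 e2 e3.
by rewrite -{2}e2 e1 e3.
Qed.

Lemma actionNK g : {ae nu, forall y, S (- g) (S g y) = y}.
Proof.
case: aS => _ _ /(_ (- g) g); rewrite addNr => h.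
by apply: filterS2 h action0 => y <-.
Qed.

Lemma actionKN g : {ae nu, forall y, S g (S (- g) y) = y}.
Proof.
case: aS => _ _ /(_ g (- g)); rewrite addrN => h.
by apply: filterS2 h action0 => y <-.
Qed.

Let mS : measurable_fun setT (fun p : borel_group G * Y => S p.1 p.2).
Proof. by case: aS. Qed.

Lemma measurable_fun_action {d} {Z : measurableType d} (g : Z -> borel_group G)
    (f : Z -> Y) : measurable_fun setT g -> measurable_fun setT f ->
  measurable_fun setT (fun z => S (g z) (f z)).
Proof.
move=> mg mf; apply: (measurableT_comp mS (g := fun z => (g z, f z))).
exact/measurable_fun_pair.
Qed.

Lemma measurable_opp_cocycle {d} {Z : measurableType d} (g : Z -> borel_group G) :
  measurable_fun setT g -> measurable_fun setT (fun z => - (g z : G) : borel_group G).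
Proof.
move=> mg; apply: (@measurableT_comp _ _ _ _ _ _ (fun g : borel_group G => - (g : G) : borel_group G)) => //.
apply: (@measurability _ _ (borel_group G) (borel_group G) setT (fun g => - (g : G) : borel_group G) (@open (pointed_group G)) erefl) => _ [A oA <-].
rewrite setTI; apply: sub_sigma_algebra.
have /continuousP := @opp_continuous G; exact.
Qed.

Lemma measure_preserving_rokhlin_extension : measure_preserving mu T ->
  measure_preserving (mu \x nu)%E (rokhlin_extension T phi S).
Proof.
move=> pT; apply: (measure_preserving_skew (U := fun x => S (phi x)) pT) => [x|].
  exact: measure_preserving_action.
apply: measurable_fun_action; last exact: measurable_snd.
by apply: measurableT_comp => //; exact: measurable_fst.
Qed.

Lemma rokhlin_extension_automorphism : standard_borel R Y -> automorphism mu T ->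
  automorphism (mu \x nu)%E (rokhlin_extension T phi S).
Proof.
move=> sY [pT [T' [pT' T'T TT']]].
have mphi1 : measurable_fun setT (fun p : X * Y => phi p.1).
  by apply: measurableT_comp => //; exact: measurable_fst.
have mphiT' : measurable_fun setT (phi \o T').
  by apply: measurableT_comp => //; case: pT'.
have mphiT1 : measurable_fun setT (fun p : X * Y => phi (T' p.1)).
  by apply: (measurableT_comp mphiT'); exact: measurable_fst.
(* The group identities hold for each [x] off a null set of [y] depending on [x]; the measurable
   diagonal makes them hold almost everywhere on the product. *)
have eqm (f : X * Y -> Y) : measurable_fun setT f ->
    (forall x, {ae nu, forall y, f (x, y) = y}) ->
    {ae (mu \x nu)%E, forall p, f p = p.2}.
  move=> mf fy; apply: (ae_product (P := [set p | f p = p.2])); last exact: aeW.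
  rewrite -[X in measurable X]setTI.
  have mff : measurable_fun setT (fun p : X * Y => (f p, p.2)).
    by apply/measurable_fun_pair => //; exact: measurable_snd.
  exact: (mff measurableT _ (standard_borel_measurable_diagonal sY)).
split; first exact: measure_preserving_rokhlin_extension.
(* The fibre move to be undone was made at the previous base point, hence [phi] is taken at
   [T' p.1]. *)
exists (fun p => (T' p.1, S (- (phi (T' p.1) : G)) p.2)); split.
- apply: (measure_preserving_skew (U := fun x => S (- (phi (T' x) : G))) pT') => [x|].
    exact: measure_preserving_action.
  by apply: measurable_fun_action; [exact: measurable_opp_cocycle|exact: measurable_snd].
- have h : {ae (mu \x nu)%E, forall p, S (- (phi p.1 : G)) (S (phi p.1) p.2) = p.2}.
    apply: (eqm (fun p => S (- (phi p.1 : G)) (S (phi p.1) p.2))) => [|x].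
      apply: measurable_fun_action; first exact: measurable_opp_cocycle.
      by apply: measurable_fun_action => //; exact: measurable_snd.
    exact: (actionNK (phi x : G)).
  apply: filterS2 h (ae_fst nu T'T) => -[x y] /= h1 h2.
  by rewrite h2 h1.
- have h : {ae (mu \x nu)%E, forall p, S (phi (T' p.1)) (S (- (phi (T' p.1) : G)) p.2) = p.2}.
    apply: (eqm (fun p => S (phi (T' p.1)) (S (- (phi (T' p.1) : G)) p.2))) => [|x].
      apply: measurable_fun_action => //.
      by apply: measurable_fun_action; [exact: measurable_opp_cocycle|exact: measurable_snd].
    exact: (actionKN (phi (T' x) : G)).
  apply: filterS2 h (ae_fst nu TT') => -[x y] /= h1 h2.
  by rewrite /rokhlin_extension /= h2 h1.
Qed.

(** The iterate is kept literally, because it agrees with the action of the Birkhoff sum of [phi]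
    only for almost every [y]. *)
Definition fiber_iter n x : Y -> Y := fun y => (iter n (rokhlin_extension T phi S) (x, y)).2.

Lemma iter_rokhlin_extension n x y :
  iter n (rokhlin_extension T phi S) (x, y) = (iter n T x, fiber_iter n x y).
Proof.
rewrite /fiber_iter [LHS]surjective_pairing; congr pair.
by elim: n => //= n ->.
Qed.

Lemma fiber_iterS n x y : fiber_iter n.+1 x y = S (phi (iter n T x)) (fiber_iter n x y).
Proof. by rewrite /fiber_iter /= iter_rokhlin_extension. Qed.

Lemma measure_preserving_fiber_iter n x : measure_preserving nu (fiber_iter n x).
Proof.
elim: n => [|n ih]; first exact: measure_preserving_id.
rewrite (_ : fiber_iter n.+1 x = S (phi (iter n T x)) \o fiber_iter n x); last first.
  by apply/funext => y; rewrite fiber_iterS.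
by apply: measure_preserving_comp => //; exact: measure_preserving_action.
Qed.

Lemma fiber_iterE n x :
  {ae nu, forall y, fiber_iter n x y = S (\sum_(i < n) (phi (iter i T x) : G)) y}.
Proof.
elim: n => [|n ih].
  rewrite big_ord0; apply: filterS action0 => y ->.
  by [].
case: aS => _ _ /(_ (phi (iter n T x)) (\sum_(i < n) (phi (iter i T x) : G))) h.
apply: filterS2 h ih => y h1 h2.
by rewrite fiber_iterS h2 big_ord_recr /= addrC h1.
Qed.

End RokhlinExtension.

(** * The spectral representation *)

Section PolynomialFunctional.
Context {R : comNzRingType}.
Implicit Types (e : nat -> R) (p : {poly R}).

(** Polynomials act as the free module on the iterates of an operator: ['X^i] is sent to the [i]-th
    iterate, and multiplication by ['X^k] applies the operator [k] more times. *)
Definition coef_functional e p := \sum_(i < size p) p`_i * e i.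

Lemma coef_functional_widen e p N : (size p <= N)%N ->
  coef_functional e p = \sum_(i < N) p`_i * e i.
Proof.
move=> pN; rewrite /coef_functional (big_ord_widen N (fun i => p`_i * e i))//.
rewrite big_mkcond; apply: eq_bigr => i _; case: ltnP => // h.
by rewrite nth_default// mul0r.
Qed.

Lemma coef_functionalD e p1 p2 :
  coef_functional e (p1 + p2) = coef_functional e p1 + coef_functional e p2.
Proof.
pose N := maxn (size p1) (size p2).
rewrite !(@coef_functional_widen e _ N) ?leq_maxl ?leq_maxr ?size_polyD//.
by rewrite -big_split; apply: eq_bigr => i _; rewrite coefD mulrDl.
Qed.

Lemma coef_functionalZ e a p : coef_functional e (a *: p) = a * coef_functional e p.
Proof.
rewrite (@coef_functional_widen e (a *: p) (size p)) ?size_scale_leq//.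
by rewrite /coef_functional big_distrr; apply: eq_bigr => i _; rewrite coefZ /= mulrA.
Qed.

Lemma coef_functional1 e : coef_functional e 1 = e 0%N.
Proof. by rewrite /coef_functional size_poly1 big_ord1 coef1 mul1r. Qed.

Lemma coef_functional_XnM e k p :
  coef_functional e ('X^k * p) = coef_functional (fun i => e (k + i)%N) p.
Proof.
rewrite (@coef_functional_widen e _ (k + size p)); last first.
  rewrite (leq_trans (size_polyMleq _ _))// size_polyXn addSn /=//.
rewrite big_split_ord /= big1 ?add0r => [|i _]; last first.
  by rewrite coefXnM ltn_ord mul0r.
by apply: eq_bigr => i _; rewrite coefXnM ltnNge leq_addr /= addnC addnK addnC.
Qed.

Lemma coef_functional_lin e e' a b p :
  coef_functional (fun i => a * e i + b * e' i) p =
  a * coef_functional e p + b * coef_functional e' p.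
Proof.
rewrite /coef_functional !big_distrr -big_split /=.
by apply: eq_bigr => i _; ring.
Qed.

End PolynomialFunctional.

Section CharacterTheory.
Context {R : realType} {G : topologicalZmodType}.
Implicit Types (chi : dual R G) (g h : G).

Lemma character0 chi : character chi 0 = 1.
Proof.
have c0 : character chi 0 != 0 by rewrite -normr_eq0 norm_character oner_eq0.
by apply: (mulfI c0); rewrite -characterD addr0 mulr1.
Qed.

Lemma characterB chi g h :
  character chi (g - h) = character chi g * ((character chi h)^*)%C.
Proof.
have h1 := mulJ_unit (norm_character chi h).
rewrite -[LHS]mulr1 -h1 mulrA -characterD subrK//.
Qed.

Lemma character_sum chi n (g : nat -> G) :
  character chi (\sum_(i < n) g i) = \prod_(i < n) character chi (g i).
Proof.
elim: n => [|n ih]; first by rewrite !big_ord0 character0.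
by rewrite !big_ord_recr /= characterD ih.
Qed.

Lemma bounded_measurable_Re_character g :
  bounded_measurable (fun chi : borel (dual R G) => complex.Re (character chi g)).
Proof.
split; first exact: measurable_Re_evaluation.
by exists 1 => chi; exact/Re_unit_le1/norm_character.
Qed.

Lemma bounded_measurable_Im_character g :
  bounded_measurable (fun chi : borel (dual R G) => complex.Im (character chi g)).
Proof.
split; first exact: measurable_Im_evaluation.
by exists 1 => chi; exact/Im_unit_le1/norm_character.
Qed.

End CharacterTheory.

Section SpectralIsometry.
Context {R : realType} {G : topologicalZmodType} {d} {Y : measurableType d}.
Variables (nu : probability Y R) (S : G -> Y -> Y) (f : Y -> R).
Variable tau : {finite_measure set (borel (dual R G)) -> \bar R}.
Hypotheses (aS : measurable_action nu S) (bf : bounded_measurable f)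
  (ftau : is_spectral_measure nu S (fun y => (f y)%:C%C) tau).

Let bfS g : bounded_measurable (fun y => f (S g y)).
Proof.
by apply: (bounded_measurable_comp bf); case: (measure_preserving_action aS g).
Qed.

(** The integrand is the real part of [character chi (g - h)], so the spectral measure at [g - h]
    applies; invariance under [S h] then moves both factors of the correlation. *)
Lemma Rintegral_Re_character g h :
  \int[tau]_chi (complex.Re (character chi g) * complex.Re (character chi h) +
                 complex.Im (character chi g) * complex.Im (character chi h)) =
  \int[nu]_y (f (S g y) * f (S h y)).
Proof.
transitivity (\int[tau]_chi complex.Re (character chi (g - h))).
  apply: eq_Rintegral => chi _; rewrite characterB complex_ReM.
  by case: (character chi h) => u v /=; ring.
have := ftau (g - h); rewrite /integralC => -[-> _].
rewrite -(Rintegral_measure_preserving (measure_preserving_action aS h)); last first.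
  rewrite (_ : (fun y => _) = fun y => f (S (g - h) y) * f y).
    by case: (bounded_measurableM (bfS (g - h)) bf).
  by apply/funext => y /=; ring.
rewrite /Rintegral; congr fine.
have mE := bounded_measurableM (bfS (g - h)) bf.
have mgh := bounded_measurable_comp mE (measure_preserving_action aS h).1.
rewrite (_ : (fun y => _) = EFin \o ((fun y => f (S (g - h) y) * f y) \o S h)); last first.
  by apply/funext => y /=; congr EFin; ring.
apply: ae_eq_integral => //.
- by apply/measurable_EFinP; case: mgh.
- by apply/measurable_EFinP; case: (bounded_measurableM (bfS g) (bfS h)).
case: aS => _ _ /(_ (g - h) h); apply: filterS => y; rewrite subrK => e _ /=.
by rewrite e.
Qed.

(** Sending [f \o S g] to the evaluation of characters at [g] preserves inner products, so both
    squares expand into the same Gram matrix. *)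
Lemma spectral_isometry n (c : nat -> R) (g : nat -> G) :
  \int[tau]_chi ((\sum_(i < n) c i * complex.Re (character chi (g i))) ^+ 2 +
                 (\sum_(i < n) c i * complex.Im (character chi (g i))) ^+ 2) =
  \int[nu]_y ((\sum_(i < n) c i * f (S (g i) y)) ^+ 2).
Proof.
have sqs (e : nat -> R) : (\sum_(i < n) c i * e i) ^+ 2 =
    \sum_(i < n) \sum_(j < n) (c i * c j) * (e i * e j).
  rewrite expr2 big_distrl; apply: eq_bigr => i _; rewrite big_distrr.
  by apply: eq_bigr => j _ /=; ring.
under [RHS]eq_Rintegral do rewrite (sqs (fun i => f (S (g i) _))).
have bff i j := bounded_measurableM (bfS (g i)) (bfS (g j)).
rewrite Rintegral_sum => [|i]; last first.
  by apply: bounded_measurable_sum => j; exact: bounded_measurableZ.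
transitivity (\int[tau]_chi (\sum_(i < n) \sum_(j < n) (c i * c j) *
   (complex.Re (character chi (g i)) * complex.Re (character chi (g j)) +
    complex.Im (character chi (g i)) * complex.Im (character chi (g j))))).
  apply: eq_Rintegral => chi _.
  rewrite (sqs (fun i => complex.Re (character chi (g i)))).
  rewrite (sqs (fun i => complex.Im (character chi (g i)))) -big_split.
  apply: eq_bigr => i _; rewrite -big_split; apply: eq_bigr => j _ /=; ring.
have bch i j : bounded_measurable (fun chi : borel (dual R G) =>
   (complex.Re (character chi (g i)) * complex.Re (character chi (g j)) +
    complex.Im (character chi (g i)) * complex.Im (character chi (g j)))).
  by apply: bounded_measurableD; apply: bounded_measurableM;
    (exact: bounded_measurable_Re_character || exact: bounded_measurable_Im_character).
rewrite Rintegral_sum => [|i]; last first.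
  by apply: bounded_measurable_sum => j; exact: bounded_measurableZ.
apply: eq_bigr => i _.
rewrite Rintegral_sum => [|j]; last exact: bounded_measurableZ.
rewrite Rintegral_sum => [|j]; last exact: bounded_measurableZ.
apply: eq_bigr => j _.
rewrite !RintegralZl//; try exact: bounded_measurable_integrable.
by rewrite Rintegral_Re_character.
Qed.

End SpectralIsometry.

Section RokhlinIsometry.
Context {R : realType} {dX} {X : measurableType dX} {dY} {Y : measurableType dY}.
Context {G : topologicalZmodType}.
Variables (mu : probability X R) (nu : probability Y R).
Variables (T : X -> X) (phi : X -> borel_group G) (S : G -> Y -> Y).
Variables (a : X -> R) (f : Y -> R).
Variable tau : {finite_measure set (borel (dual R G)) -> \bar R}.
Hypotheses (G2 : @second_countable G) (pT : measure_preserving mu T)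
  (mphi : measurable_fun setT phi) (aS : measurable_action nu S)
  (ba : bounded_measurable a) (bf : bounded_measurable f)
  (ftau : is_spectral_measure nu S (fun y => (f y)%:C%C) tau).

Local Notation Rt := (rokhlin_extension T phi S).
Implicit Types p : {poly R}.

Definition cocycle_character n (z : X * borel (dual R G)) : R[i] :=
  \prod_(i < n) character z.2 (phi (iter i T z.1)).

Definition tensor_iter i (z : X * Y) : R := a (iter i Rt z).1 * f (iter i Rt z).2.

(* [p] stands for the combination of the iterates of [a(x) f(y)] under the
   Koopman operator of the extension with coefficients those of [p]; [spectral_Re]
   and [spectral_Im] are the real and imaginary parts of its image in the
   spectral representation, where the Koopman operator of the extension becomes
   [u(x, chi) |-> chi (phi x) * u(T x, chi)]. *)
Definition tensor_combination p (z : X * Y) := coef_functional (tensor_iter ^~ z) p.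

Definition spectral_Re p (z : X * borel (dual R G)) := coef_functional
  (fun i => a (iter i T z.1) * complex.Re (cocycle_character i z)) p.

Definition spectral_Im p (z : X * borel (dual R G)) := coef_functional
  (fun i => a (iter i T z.1) * complex.Im (cocycle_character i z)) p.

Let pRt : measure_preserving (mu \x nu)%E Rt.
Proof. exact: measure_preserving_rokhlin_extension. Qed.

Let mTn n : measurable_fun setT (iter n T).
Proof. by case: (measure_preserving_iter n pT). Qed.

Lemma cocycle_characterD k n z : cocycle_character (k + n) z =
  cocycle_character k z * cocycle_character n (iter k T z.1, z.2).
Proof.
rewrite /cocycle_character big_split_ord /=; congr (_ * _).
by apply: eq_bigr => i _; rewrite addnC iterD.
Qed.

Lemma tensor_combination_XnM k p z :
  tensor_combination ('X^k * p) z = tensor_combination p (iter k Rt z).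
Proof.
rewrite /tensor_combination coef_functional_XnM; congr (coef_functional _ p).
by apply/funext => i; rewrite /tensor_iter addnC iterD.
Qed.

Lemma spectral_XnM k p z :
  (spectral_Re ('X^k * p) z +i* spectral_Im ('X^k * p) z)%C =
  cocycle_character k z *
  (spectral_Re p (iter k T z.1, z.2) +i* spectral_Im p (iter k T z.1, z.2))%C.
Proof.
set w := (iter k T z.1, z.2).
have ReE : spectral_Re ('X^k * p) z =
    complex.Re (cocycle_character k z) * spectral_Re p w -
    complex.Im (cocycle_character k z) * spectral_Im p w.
  rewrite -mulNr -coef_functional_lin /spectral_Re coef_functional_XnM.
  congr (coef_functional _ p); apply/funext => i.
  by rewrite cocycle_characterD complex_ReM addnC iterD; ring.
have ImE : spectral_Im ('X^k * p) z =
    complex.Re (cocycle_character k z) * spectral_Im p w +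
    complex.Im (cocycle_character k z) * spectral_Re p w.
  rewrite -coef_functional_lin /spectral_Im coef_functional_XnM.
  congr (coef_functional _ p); apply/funext => i.
  by rewrite cocycle_characterD complex_ImM addnC iterD; ring.
by rewrite ReE ImE; case: (cocycle_character k z).
Qed.

Lemma bounded_tensor_combination p : bounded_measurable (tensor_combination p).
Proof.
have mRtn n : measurable_fun setT (iter n Rt).
  by case: (measure_preserving_iter n pRt).
apply: bounded_measurable_sum => i; apply: bounded_measurableZ.
have ba1 : bounded_measurable (fun z : X * Y => a z.1).
  by apply: (bounded_measurable_comp ba); exact: measurable_fst.
have bf2 : bounded_measurable (fun z : X * Y => f z.2).
  by apply: (bounded_measurable_comp bf); exact: measurable_snd.
apply: bounded_measurableM.
  exact: (bounded_measurable_comp ba1 (mRtn i)).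
exact: (bounded_measurable_comp bf2 (mRtn i)).
Qed.

Lemma measurable_cocycle_character n : Defs.measurableC (cocycle_character n).
Proof.
rewrite /cocycle_character; elim: n => [|n ih].
  by under eq_fun do rewrite big_ord0; split; exact: measurable_cst.
under eq_fun do rewrite big_ord_recr; apply: measurableCM => //=.
have mg : measurable_fun setT (fun z : X * borel (dual R G) => (phi (iter n T z.1), z.2)).
  apply/measurable_fun_pair; last exact: measurable_snd.
  apply: (measurableT_comp mphi); apply: (measurableT_comp (mTn n)).
  exact: measurable_fst.
split.
  exact: (measurableT_comp (measurable_character_Re G2) mg).
exact: (measurableT_comp (measurable_character_Im G2) mg).
Qed.

Let maT i : measurable_fun setT (fun z : X * borel (dual R G) => a (iter i T z.1)).
Proof.
have [ma _] := ba; apply: (measurableT_comp ma); apply: (measurableT_comp (mTn i)).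
exact: measurable_fst.
Qed.

Lemma measurable_spectral_Re p : measurable_fun setT (spectral_Re p).
Proof.
apply: measurable_sum => i; apply: measurable_funM => //.
by apply: measurable_funM => //; case: (measurable_cocycle_character i).
Qed.

Lemma measurable_spectral_Im p : measurable_fun setT (spectral_Im p).
Proof.
apply: measurable_sum => i; apply: measurable_funM => //.
by apply: measurable_funM => //; case: (measurable_cocycle_character i).
Qed.

(** For fixed [x], the cocycle is a character evaluated at a Birkhoff sum of [phi], so the isometry
    over [Y] applies with the real coefficients [p_i a(T^i x)]; Tonelli integrates over [x]. *)
Lemma rokhlin_spectral_isometry p :
  (\int[mu \x tau]_z (spectral_Re p z ^+ 2 + spectral_Im p z ^+ 2)%:E =
   \int[mu \x nu]_z (tensor_combination p z ^+ 2)%:E)%E.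
Proof.
have bW := bounded_tensor_combination p.
have mL : measurable_fun setT (fun z => (spectral_Re p z ^+ 2 + spectral_Im p z ^+ 2)%:E).
  apply/measurable_EFinP/measurable_funD; apply: measurable_funX.
    exact: measurable_spectral_Re.
  exact: measurable_spectral_Im.
have mR : measurable_fun setT (fun z => (tensor_combination p z ^+ 2)%:E).
  by apply/measurable_EFinP/measurable_funX; case: bW.
rewrite (@fubini_tonelli1 _ _ _ _ _ mu tau _ mL) => [|z]; last by rewrite lee_fin addr_ge0// sqr_ge0.
rewrite (@fubini_tonelli1 _ _ _ _ _ mu nu _ mR) => [|z]; last by rewrite lee_fin sqr_ge0.
apply: eq_integral => x _; rewrite /fubini_F.
pose c i := p`_i * a (iter i T x).
pose g i : G := \sum_(j < i) (phi (iter j T x) : G).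
have ccE i chi : cocycle_character i (x, chi) = character chi (g i).
  by rewrite /g (character_sum chi i (fun j => phi (iter j T x))).
have bcRe i := bounded_measurableZ (c i) (bounded_measurable_Re_character (R := R) (g i)).
have bcIm i := bounded_measurableZ (c i) (bounded_measurable_Im_character (R := R) (g i)).
have bRe := bounded_measurable_sum (index_enum 'I_(size p)) xpredT (fun i => bcRe i).
have bIm := bounded_measurable_sum (index_enum 'I_(size p)) xpredT (fun i => bcIm i).
transitivity (\int[tau]_chi
   ((\sum_(i < size p) c i * complex.Re (character chi (g i))) ^+ 2 +
    (\sum_(i < size p) c i * complex.Im (character chi (g i))) ^+ 2)%:E)%E.
  apply: eq_integral => chi _; congr (_ ^+ 2 + _ ^+ 2)%:E.
    by apply: eq_bigr => i _; rewrite ccE /c mulrA.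
  by apply: eq_bigr => i _; rewrite ccE /c mulrA.
rewrite -EFin_Rintegral; last first.
  have bRe2 := bounded_measurableM bRe bRe; have bIm2 := bounded_measurableM bIm bIm.
  have := bounded_measurableD bRe2 bIm2.
  by congr bounded_measurable; apply/funext => chi; rewrite -!expr2.
have bS i : bounded_measurable (fun y => c i * f (S (g i) y)).
  apply: bounded_measurableZ; apply: (bounded_measurable_comp bf).
  by case: (measure_preserving_action aS (g i)).
have bSS := bounded_measurable_sum (index_enum 'I_(size p)) xpredT (fun i => bS i).
rewrite (spectral_isometry aS bf ftau) EFin_Rintegral; last first.
  by have := bounded_measurableM bSS bSS; congr bounded_measurable.
apply: ae_eq_integral => //.
- by apply/measurable_EFinP/measurable_funX; case: bSS.
- apply: (measurableT_comp mR (g := fun y => (x, y))).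
  by apply/measurable_fun_pair => //; exact: measurable_cst.
have : {ae nu, forall y, forall i, fiber_iter T phi S i x y = S (g i) y}.
  by apply: ae_foralln => i; exact: fiber_iterE.
apply: filterS => y e _; congr (_ ^+ 2)%:E.
by apply: eq_bigr => i _; rewrite /tensor_iter iter_rokhlin_extension /= e /c mulrA.
Qed.

End RokhlinIsometry.

(** * Rigid sets of the extension *)

Lemma sqr_cvg0 {R : realType} (u : nat -> R) :
  u n ^+ 2 @[n --> \oo] --> 0 -> u n @[n --> \oo] --> 0.
Proof.
move=> /cvgrPdist_lt h; apply/cvgrPdist_lt => e e0.
have e2 : 0 < e ^+ 2 by rewrite exprn_gt0.
apply: filterS (h _ e2) => n /=; rewrite !sub0r !normrN normrX.
by rewrite ltr_pXn2r// nnegrE ?normr_ge0// ltW.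
Qed.

Lemma bounded_cvg0M {R : realType} (b u : nat -> R) : (forall n, `|b n| <= 1) ->
  u n @[n --> \oo] --> 0 -> b n * u n @[n --> \oo] --> 0.
Proof.
move=> b1 /cvgrPdist_lt h; apply/cvgrPdist_lt => e e0.
apply: filterS (h _ e0) => n /=; rewrite !sub0r !normrN; apply: le_lt_trans.
by rewrite normrM ler_piMl.
Qed.

Section RigidOrthogonality.
Context {R : realType} {dX} {X : measurableType dX} {dY} {Y : measurableType dY}.
Context {G : topologicalZmodType}.
Variables (mu : probability X R) (nu : probability Y R).
Variables (T : X -> X) (phi : X -> borel_group G) (S : G -> Y -> Y).
Variables (a : X -> R) (f : Y -> R).
Variables tau sigma : {finite_measure set (borel (dual R G)) -> \bar R}.
Variables (q : nat -> nat) (A : set (X * Y)).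
Hypotheses (G2 : @second_countable G) (mm : mildly_mixing mu T)
  (mphi : measurable_fun setT phi) (aS : measurable_action nu S)
  (ba : bounded_measurable a) (bf : bounded_measurable f)
  (ftau : is_spectral_measure nu S (fun y => (f y)%:C%C) tau)
  (tausigma : tau `<< sigma) (sigma0 : sigma.-negligible (Sigma_group mu T phi))
  (qoo : q n @[n --> \oo] --> \oo) (mA : measurable A).

Local Notation Rt := (rokhlin_extension T phi S).
Local Notation W := (tensor_combination T phi S a f).
Local Notation uR := (spectral_Re T phi a).
Local Notation uI := (spectral_Im T phi a).
Local Notation cc := (cocycle_character (R := R) T phi).

Let P : probability (X * Y)%type R := [the probability _ _ of (mu \x nu)%E].

Hypothesis rA : (\int[P]_z
  ((\1_A (iter (q n) Rt z) - \1_A z : R) ^+ 2)%:E)%E @[n --> \oo] --> 0%E.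

Let pT : measure_preserving mu T.
Proof. by case: mm => [[]]. Qed.

Let bW p : bounded_measurable (W p).
Proof. exact: (@bounded_tensor_combination _ _ _ _ _ _ mu nu). Qed.

Let muR p : measurable_fun setT (uR p).
Proof. exact: (@measurable_spectral_Re _ _ _ _ mu). Qed.

Let muI p : measurable_fun setT (uI p).
Proof. exact: (@measurable_spectral_Im _ _ _ _ mu). Qed.

Let B (p r : {poly R}) : R := \int[P]_z (W p z * W r z).
Let l (p : {poly R}) : R := \int[P]_z (\1_A z * W p z).

Let intP (g : X * Y -> R) : bounded_measurable g ->
  P.-integrable setT (EFin \o g).
Proof. exact: bounded_measurable_integrable. Qed.

Let iWW p r := intP (bounded_measurableM (bW p) (bW r)).

Let bA : bounded_measurable (\1_A : X * Y -> R).
Proof. exact: bounded_measurable_indic. Qed.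

Let iAW p := intP (bounded_measurableM bA (bW p)).

Let BD p r s : B (p + r) s = B p s + B r s.
Proof.
rewrite /B -RintegralD//; apply: eq_Rintegral => z _.
by rewrite /tensor_combination coef_functionalD mulrDl.
Qed.

Let BZ c p r : B (c *: p) r = c * B p r.
Proof.
rewrite /B -RintegralZl//; apply: eq_Rintegral => z _.
by rewrite /tensor_combination coef_functionalZ mulrA.
Qed.

Let Bsym p r : B p r = B r p.
Proof. by apply: eq_Rintegral => z _; rewrite mulrC. Qed.

Let B0 p : 0 <= B p p.
Proof. by apply: Rintegral_ge0 => z _; rewrite -expr2 sqr_ge0. Qed.

Let lD p r : l (p + r) = l p + l r.
Proof.
rewrite /l -RintegralD//; apply: eq_Rintegral => z _.
by rewrite /tensor_combination coef_functionalD mulrDr.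
Qed.

Let lZ c p : l (c *: p) = c * l p.
Proof.
rewrite /l -RintegralZl//; apply: eq_Rintegral => z _.
by rewrite /tensor_combination coef_functionalZ mulrCA.
Qed.

Let lB p : 2 * l p - B p p <= 1.
Proof.
have i1 := intP (bounded_measurable_cst 1).
have i2A := intP (bounded_measurableZ 2 (bounded_measurableM bA (bW p))).
have i2 := intP
  (bounded_measurableB (bounded_measurableZ 2 (bounded_measurableM bA (bW p))) (bounded_measurableM (bW p) (bW p))).
rewrite /l /B -RintegralZl// -RintegralB//.
apply: (@le_trans _ _ (\int[P]_z (1 : R))).
  apply: le_Rintegral => // z _.
  rewrite indicE; case: (_ \in A) => /=; have := sqr_ge0 (W p z - 1); have := sqr_ge0 (W p z); nra.
rewrite Rintegral_cst// mul1r -[leRHS]/(fine 1%E) le_eqVlt; apply/orP; left; apply/eqP.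
by congr fine; exact: (@probability_setT _ _ _ P).
Qed.

Let U n (p : {poly R}) := 'X^(q n) * p.

Let pRtn n : measure_preserving P (iter n Rt).
Proof. by apply: measure_preserving_iter; exact: measure_preserving_rokhlin_extension. Qed.

Let BU n p : B (U n p) (U n p) = B p p.
Proof.
rewrite /B -(Rintegral_measure_preserving (f := fun z => W p z * W p z) (pRtn (q n))); last first.
  by case: (bounded_measurableM (bW p) (bW p)).
by apply: eq_Rintegral => z _; rewrite /U tensor_combination_XnM.
Qed.

(** By invariance, [l p] can be computed after moving both [\1_A] and [W p] by the iterate; it then
    differs from [l (U n p)] only through the displacement of [\1_A], weighted by the bounded
    [W p]. *)
Let lU p : l (U n p) @[n --> \oo] --> l p.
Proof.
have [_ [M WM]] := bW p.
have M0 : 0 <= M by rewrite (le_trans (normr_ge0 _) (WM point)).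
pose rho n z : R := (\1_A (iter (q n) Rt z) - \1_A z) ^+ 2.
have bAU n : bounded_measurable (fun z => \1_A (iter (q n) Rt z) : R).
  by apply: (bounded_measurable_comp bA); case: (pRtn (q n)).
have brho n : bounded_measurable (rho n).
  have := bounded_measurableM (bounded_measurableB (bAU n) bA) (bounded_measurableB (bAU n) bA).
  by congr bounded_measurable.
have bWU n : bounded_measurable (fun z => W p (iter (q n) Rt z)).
  by apply: (bounded_measurable_comp (bW p)); case: (pRtn (q n)).
have crho : \int[P]_z rho n z @[n --> \oo] --> 0.
  by have /fine_cvgP[_] := rA.
apply/cvgrPdist_le => e e0.
have eM : 0 < e / (M + 1) by rewrite divr_gt0// ltr_wpDl.
move/cvgrPdist_le : crho => /(_ _ eM); apply: filterS => n.
rewrite sub0r normrN ger0_norm; last by apply: Rintegral_ge0 => z _; rewrite sqr_ge0.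
move=> rn.
have -> : l p = \int[P]_z (\1_A (iter (q n) Rt z) * W p (iter (q n) Rt z)).
  rewrite (Rintegral_measure_preserving (f := fun z => \1_A z * W p z) (pRtn (q n)))//.
  by case: (bounded_measurableM bA (bW p)).
have -> : l (U n p) = \int[P]_z (\1_A z * W p (iter (q n) Rt z)).
  by apply: eq_Rintegral => z _; rewrite tensor_combination_XnM.
have b1 := bounded_measurableM (bAU n) (bWU n).
have b2 := bounded_measurableM bA (bWU n).
have i1 := intP b1.
have i2 := intP b2.
have i12 := intP (bounded_measurableB b1 b2).
rewrite -RintegralB//.
apply: (le_trans (le_normr_Rintegral measurableT i12)).
apply: (@le_trans _ _ (\int[P]_z (M * rho n z))).
  apply: le_Rintegral => //.
  - exact: integrable_norm.
  - exact: (intP (bounded_measurableZ M (brho n))).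
  (* The absolute value of a difference of indicators equals its square, so rigidity in [L^2]
     controls this integral. *)
  move=> z _; rewrite -mulrBl normrM mulrC ler_pM//.
  rewrite /rho; move: (iter (q n) Rt z) => w; rewrite !indicE.
  by case: (w \in A); case: (z \in A); rewrite /= ?subrr ?subr0 ?sub0r ?normrN ?normr0 ?normr1 ?sqrrN ?expr1n ?expr0n.
rewrite RintegralZl//; last exact: intP.
apply: (@le_trans _ _ (M * (e / (M + 1)))); first exact: ler_wpM2l.
rewrite mulrA ler_pdivrMr; last by rewrite ltr_wpDl.
by rewrite mulrC ler_pM2l// lerDl.
Qed.

Let EB p : (\int[(mu \x tau)%E]_z (uR p z ^+ 2 + uI p z ^+ 2)%:E)%E = (B p p)%:E.
Proof.
rewrite (@rokhlin_spectral_isometry _ _ _ _ _ _ mu nu T phi S a f tau)//.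
rewrite /B EFin_Rintegral; last exact: bounded_measurableM.
by apply: eq_integral => z _; rewrite expr2.
Qed.

Let uRB p r z : uR (p - r) z = uR p z - uR r z.
Proof. by rewrite /spectral_Re coef_functionalD -scaleN1r coef_functionalZ mulN1r. Qed.

Let uIB p r z : uI (p - r) z = uI p z - uI r z.
Proof. by rewrite /spectral_Im coef_functionalD -scaleN1r coef_functionalZ mulN1r. Qed.

(* The image [h] in the spectral representation of the projection of [\1_A] to
   the cyclic space of [a(x) f(y)] is rigid, so almost all of its fibres vanish
   because [Sigma_group] is negligible. *)
Lemma rigid_set_orthogonal : \int[P]_z (\1_A z * (a z.1 * f z.2)) = 0.
Proof.
have [p [k [C [kn pC UpC lpC]]]] := fast_Riesz_sequence BD BZ Bsym B0 lD lZ lB BU lU.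
have C0 : 0 <= C by have := UpC 0%N; rewrite expr0 mulr1; apply: le_trans.
have half_le n : C * 4^-1 ^+ n <= C * 2^-1 ^+ n.
  by apply: ler_wpM2l => //; apply: lerXn2r; rewrite ?nnegrE; lra.
have msq (g : X * borel (dual R G) -> R) : measurable_fun setT g ->
    measurable_fun setT (fun z => (g z ^+ 2)%:E).
  by move=> mg; apply/measurable_EFinP/measurable_funX.
have uRE r : (\int[(mu \x tau)%E]_z (uR r z ^+ 2)%:E <= (B r r)%:E)%E.
  rewrite -EB; apply: ge0_le_integral => //.
  - by move=> z _; rewrite lee_fin sqr_ge0.
  - exact: msq.
  - by apply/measurable_EFinP/measurable_funD; exact: measurable_funX.
  by move=> z _; rewrite lee_fin lerDl sqr_ge0.
have uIE r : (\int[(mu \x tau)%E]_z (uI r z ^+ 2)%:E <= (B r r)%:E)%E.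
  rewrite -EB; apply: ge0_le_integral => //.
  - by move=> z _; rewrite lee_fin sqr_ge0.
  - exact: msq.
  - by apply/measurable_EFinP/measurable_funD; exact: measurable_funX.
  by move=> z _; rewrite lee_fin lerDr sqr_ge0.
have EFC n m : (n <= m)%N -> ((B (p m - p n) (p m - p n))%:E <= (C * 4^-1 ^+ n)%:E)%E.
  by move=> nm; rewrite lee_fin; exact: pC.
have [hr [mhr chr hrC]] : exists h : X * borel (dual R G) -> R, [/\ measurable_fun setT h,
    {ae (mu \x tau)%E, forall z, uR (p n) z @[n --> \oo] --> h z} &
    forall n, (\int[(mu \x tau)%E]_z ((h z - uR (p n) z) ^+ 2)%:E <= (C * 4^-1 ^+ n)%:E)%E].
  apply: fast_L2_limit => // n m nm; apply: le_trans (EFC n m nm).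
  by under eq_integral do rewrite -uRB; exact: uRE.
have [hi [mhi chi hiC]] : exists h : X * borel (dual R G) -> R, [/\ measurable_fun setT h,
    {ae (mu \x tau)%E, forall z, uI (p n) z @[n --> \oo] --> h z} &
    forall n, (\int[(mu \x tau)%E]_z ((h z - uI (p n) z) ^+ 2)%:E <= (C * 4^-1 ^+ n)%:E)%E].
  apply: fast_L2_limit => // n m nm; apply: le_trans (EFC n m nm).
  by under eq_integral do rewrite -uIB; exact: uIE.
pose Q n := q (k n).
pose V n (z : X * borel (dual R G)) := (iter (Q n) T z.1, z.2).
have pV n : measure_preserving (mu \x tau)%E (V n).
  apply: (@measure_preserving_skew _ _ _ _ _ mu tau _ (fun _ => id)).
  - exact: measure_preserving_iter.
  - by move=> x; exact: measure_preserving_id.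
  - exact: measurable_snd.
(* The error is evaluated at a point that moves with [n]. Since [V n] preserves the measure, its
   integral keeps the summable bound, which gives convergence at almost every [z]. *)
have cvgV (h : X * borel (dual R G) -> R) (u : nat -> X * borel (dual R G) -> R) :
    measurable_fun setT h -> (forall n, measurable_fun setT (u n)) ->
    (forall n, (\int[(mu \x tau)%E]_z ((h z - u n z) ^+ 2)%:E <= (C * 4^-1 ^+ n)%:E)%E) ->
    {ae (mu \x tau)%E, forall z, h (V n z) - u n (V n z) @[n --> \oo] --> 0}.
  move=> mh mu_ uC.
  have md n : measurable_fun setT (fun z => h z - u n z) by exact: measurable_funB.
  have : {ae (mu \x tau)%E, forall z, (h (V n z) - u n (V n z)) ^+ 2 @[n --> \oo] --> 0}.
    apply: (ae_cvg0 (C := C) (f := fun n z => (h (V n z) - u n (V n z)) ^+ 2)) => [n|n z|n].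
    - apply: measurable_funX; apply: (measurableT_comp (md n)); by case: (pV n).
    - exact: sqr_ge0.
    rewrite (ge0_integral_measure_preserving (f := fun z => ((h z - u n z) ^+ 2)%:E) (pV n)).
    - by apply: (le_trans (uC n)); rewrite lee_fin.
    - exact: msq.
    - by move=> z; rewrite lee_fin sqr_ge0.
  by apply: filterS => z; exact: sqr_cvg0.
have cvgU (u : {poly R} -> X * borel (dual R G) -> R) :
    (forall r, measurable_fun setT (u r)) ->
    (forall r, (\int[(mu \x tau)%E]_z (u r z ^+ 2)%:E <= (B r r)%:E)%E) ->
    {ae (mu \x tau)%E, forall z, u (U (k n) (p n) - p n) z @[n --> \oo] --> 0}.
  move=> mu_ uB.
  have : {ae (mu \x tau)%E, forall z, u (U (k n) (p n) - p n) z ^+ 2 @[n --> \oo] --> 0}.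
    apply: (ae_cvg0 (C := C) (f := fun n z => u (U (k n) (p n) - p n) z ^+ 2)) => [n|n z|n].
    - exact: measurable_funX.
    - exact: sqr_ge0.
    apply: (le_trans (uB _)); rewrite lee_fin; apply: le_trans (half_le n); exact: UpC.
  by apply: filterS => z; exact: sqr_cvg0.
pose h z := (hr z +i* hi z)%C.
have cc1 n z : `|cc n z| = 1.
  by rewrite /cocycle_character normr_prod big1// => i _; exact: norm_character.
have rigid_h : {ae (mu \x tau)%E, forall z,
    cvgC (fun n => cc (Q n) z * h (V n z)) (h z)}.
  have cVr := cvgV _ _ mhr (fun n => muR (p n)) hrC.
  have cVi := cvgV _ _ mhi (fun n => muI (p n)) hiC.
  have cUr := cvgU uR muR uRE; have cUi := cvgU uI muI uIE.
  near=> z.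
  have h1 : uR (p n) z @[n --> \oo] --> hr z by near: z.
  have h2 : uI (p n) z @[n --> \oo] --> hi z by near: z.
  have h3 : hr (V n z) - uR (p n) (V n z) @[n --> \oo] --> 0 by near: z.
  have h4 : hi (V n z) - uI (p n) (V n z) @[n --> \oo] --> 0 by near: z.
  have h5 : uR (U (k n) (p n) - p n) z @[n --> \oo] --> 0 by near: z.
  have h6 : uI (U (k n) (p n) - p n) z @[n --> \oo] --> 0 by near: z.
  (* The twisted value of [h] at [V n z] is the twisted error of the [n]-th approximant there, plus
     the spectral image of [U (k n) (p n) - p n], plus that of [p n]. The first two tend to 0 and
     the last to [h z]. *)
  have sE n := spectral_XnM T phi a (Q n) (p n) z.
  split.
    have -> : (fun n => complex.Re (cc (Q n) z * h (V n z))) = fun n =>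
        complex.Re (cc (Q n) z) * (hr (V n z) - uR (p n) (V n z)) -
        complex.Im (cc (Q n) z) * (hi (V n z) - uI (p n) (V n z)) +
        (uR (U (k n) (p n) - p n) z + uR (p n) z).
      apply/funext => n; rewrite uRB subrK.
      have := congr1 (@complex.Re R) (sE n); rewrite /= !complex_ReM /= => ->.
      by rewrite /V; ring.
    rewrite -[complex.Re (h z)]add0r -[X in nbhs (X + _)](subr0 0) -[X in nbhs (_ + X)]add0r.
    apply: cvgD; last exact: cvgD.
    apply: cvgB; apply: bounded_cvg0M => // n.
      exact/Re_unit_le1/cc1.
    exact/Im_unit_le1/cc1.
  have -> : (fun n => complex.Im (cc (Q n) z * h (V n z))) = fun n =>
      complex.Re (cc (Q n) z) * (hi (V n z) - uI (p n) (V n z)) +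
      complex.Im (cc (Q n) z) * (hr (V n z) - uR (p n) (V n z)) +
      (uI (U (k n) (p n) - p n) z + uI (p n) z).
    apply/funext => n; rewrite uIB subrK.
    have := congr1 (@complex.Im R) (sE n); rewrite /= !complex_ImM /= => ->.
    by rewrite /V; ring.
  rewrite -[complex.Im (h z)]add0r -[X in nbhs (X + _)](addr0 0) -[X in nbhs (_ + X)]add0r.
  apply: cvgD; last exact: cvgD.
  apply: cvgD; apply: bounded_cvg0M => // n.
    exact/Re_unit_le1/cc1.
  exact/Im_unit_le1/cc1.
have tauSigma : {ae tau, forall chi, ~ Sigma_group mu T phi chi}.
  have [N [mN N0 SN]] := sigma0.
  exists N; split => //.
    have Nn : sigma.-null_set N by apply: negligible_null_set; exists N; split.
    exact: (tausigma Nn mN).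
  by move=> chi' /= nn; apply: SN; exact: contrapT.
have Qoo : Q n @[n --> \oo] --> \oo.
  apply: (cvg_comp k q) qoo.
  apply/cvgnyPge => m; exists m => // n /= mn; exact: leq_trans (kn n).
have mh : Defs.measurableC h by [].
have h0 : {ae (mu \x tau)%E, forall z, hr z = 0 /\ hi z = 0}.
  (* The character is fixed first: the dichotomy for cocycles is applied over each [chi], and its
     second alternative would put [chi] in [Sigma_group]. *)
  apply: (ae_product_swap (P := [set z | hr z = 0 /\ hi z = 0])).
    rewrite -[X in measurable X]setTI.
    have -> : [set: X * borel (dual R G)] `&` [set z | hr z = 0 /\ hi z = 0] =
       (setT `&` hr @^-1` [set 0]) `&` (setT `&` hi @^-1` [set 0]).
      by rewrite !setTI; apply/seteqP; split.
    by apply: measurableI; [exact: mhr|exact: mhi].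
  apply: filterS2 tauSigma (ae_ysection rigid_h) => ch nS rch.
  have mpair : measurable_fun setT (fun x : X => (x, ch)).
    by apply/measurable_fun_pair => //; exact: measurable_cst.
  have [||||h0|[c [xi [c1 mxi xi1 cE]]]] := @rigid_unimodular_cocycle _ _ _ mu T Q
      (fun x => character ch (phi x)) (fun x => h (x, ch)) mm Qoo.
  - split.
      apply: (@measurableT_comp _ _ _ _ _ _ (fun g : borel_group G => complex.Re (character ch g))) => //.
      exact: (@continuous_measurable_borel R (pointed_group G) _ (@continuous_Re_character R G ch)).
    apply: (@measurableT_comp _ _ _ _ _ _ (fun g : borel_group G => complex.Im (character ch g))) => //.
    exact: (@continuous_measurable_borel R (pointed_group G) _ (@continuous_Im_character R G ch)).
  - by move=> x; exact: norm_character.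
  - exact: (measurableC_comp mh mpair).
  - exact: rch.
  - by apply: filterS h0 => x [].
  - by exfalso; apply: nS; exists c, xi.
(* As [h] vanishes, the spectral image of [p n] is its own approximation error; the factor 2 counts
   the real and imaginary parts. *)
have Bpp n : B (p n) (p n) <= 2 * C * 4^-1 ^+ n.
  rewrite -lee_fin -EB.
  apply: (@le_trans _ _ (\int[(mu \x tau)%E]_z (((hr z - uR (p n) z) ^+ 2)%:E +
      ((hi z - uI (p n) z) ^+ 2)%:E))%E).
    rewrite le_eqVlt; apply/orP; left; apply/eqP; apply: ge0_ae_eq_integral => //.
    - by apply/measurable_EFinP/measurable_funD; exact: measurable_funX.
    - by apply: emeasurable_funD; apply: msq; exact: measurable_funB.
    - by move=> z _; rewrite lee_fin addr_ge0// sqr_ge0.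
    - by move=> z _; rewrite -EFinD lee_fin addr_ge0// sqr_ge0.
    by apply: filterS h0 => z [-> ->] _; rewrite !sub0r !sqrrN EFinD.
  rewrite ge0_integralD//; try (by move=> z _; rewrite lee_fin sqr_ge0);
    try (by apply: msq; exact: measurable_funB).
  by rewrite -mulrA mulr_natl mulr2n EFinD; apply: leeD.
(* The polynomial 1 stands for [a(x) f(y)] itself. The part [1 + B 1 1] comes from [lpC], and
   [C + B 1 1] from Cauchy-Schwarz in quadratic form, tested at plus and minus [2^-1 ^+ n]. *)
have l1 n : `|l 1| <= (1 + C + 2 * B 1 1) * 2^-1 ^+ n.
  have e4 : (4^-1 : R) ^+ n <= 2^-1 ^+ n by apply: lerXn2r; rewrite ?nnegrE; lra.
  have e40 : 0 <= (4^-1 : R) ^+ n by apply: exprn_ge0; lra.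
  have e0 : 0 < (2^-1 : R) ^+ n by apply: exprn_gt0; lra.
  have CS : `|B (p n) 1| <= (C + B 1 1) * 2^-1 ^+ n.
    have cs t : 0 <= B (p n) (p n) + 2 * t * B (p n) 1 + t ^+ 2 * B 1 1.
      have := B0 (p n + t *: 1).
      rewrite BD BZ !(Bsym _ (_ + _)) !BD !BZ (Bsym 1 (p n)).
      by congr (0 <= _); ring.
    have := cs (2^-1 ^+ n); have := cs (- 2^-1 ^+ n); have := Bpp n.
    rewrite sqrrN (_ : (4^-1 : R) ^+ n = 2^-1 ^+ n * 2^-1 ^+ n); last first.
      by rewrite -exprMn; congr (_ ^+ n); field.
    move: (2^-1 ^+ n) e0 => e e0 hB ha hb.
    rewrite ler_norml; apply/andP; split.
      rewrite -(ler_pM2l e0); move: (B0 1) hB ha hb; nra.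
    by rewrite -(ler_pM2l e0); move: (B0 1) hB ha hb; nra.
  rewrite -(subrK (B (p n) 1) (l 1)); apply: (le_trans (ler_normD _ _)).
  have := lpC 1 n; move: CS (B0 1); nra.
have l10 : l 1 = 0.
  apply/eqP; rewrite -normr_le0; apply/ler_addgt0Pr => e e0; rewrite add0r.
  have := @cvg_geometric R (1 + C + 2 * B 1 1) 2^-1.
  rewrite ger0_norm// invf_lt1 ?ltr1n// => /(_ isT) /cvgrPdist_le /(_ _ e0) [N _ /(_ N (leqnn N))].
  rewrite /= sub0r normrN => hN; apply: (le_trans (l1 N)); apply: le_trans hN.
  exact: ler_norm.
rewrite -[RHS]l10; apply: eq_Rintegral => z _.
by rewrite /tensor_combination coef_functional1.
Unshelve. all: by end_near. Qed.

End RigidOrthogonality.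

Section RigidSets.
Context {R : realType} {dX} {X : measurableType dX} {dY} {Y : measurableType dY}.
Context {G : topologicalZmodType}.
Variables (mu : probability X R) (nu : probability Y R).
Variables (T : X -> X) (phi : X -> borel_group G) (S : G -> Y -> Y).
Variables (q : nat -> nat) (A : set (X * Y)).
Hypotheses (mm : mildly_mixing mu T)
  (mphi : measurable_fun setT phi) (aS : measurable_action nu S)
  (qoo : q n @[n --> \oo] --> \oo) (mA : measurable A).

Local Notation Rt := (rokhlin_extension T phi S).
Let P : probability (X * Y)%type R := [the probability _ _ of (mu \x nu)%E].

Hypothesis rA : (\int[P]_z
  ((\1_A (iter (q n) Rt z) - \1_A z : R) ^+ 2)%:E)%E @[n --> \oo] --> 0%E.

(** The fibre maps preserve [nu], so the fibre measure over an iterate of [x] is the integral over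
    [y] of [\1_A] along the orbit of [(x, y)]. Almost everywhere convergence of these indicators and
    dominated convergence in the fibre then give a function to which mild mixing applies. *)
Lemma rigid_set_fiber_measure : exists c : R,
  {ae mu, forall x, nu (xsection A x) = c%:E}.
Proof.
have pT : measure_preserving mu T by case: mm => [[]].
have pRtn n : measure_preserving P (iter n Rt).
  by apply: measure_preserving_iter; exact: measure_preserving_rokhlin_extension.
have mI : measurable_fun setT (\1_A : X * Y -> R) by exact: measurable_indic.
have mdiff n : measurable_fun setT (fun z => (\1_A (iter (q n) Rt z) - \1_A z : R) ^+ 2).
  apply/measurable_funX/measurable_funB; last exact: measurable_indic.
  by apply: (measurableT_comp mI); case: (pRtn (q n)).
(* Rigidity in the mean becomes pointwise along times with summable errors; [n <= k n] keeps these
   times tending to infinity. *)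
have /choice[k kP] : forall n, exists k, (n <= k)%N /\
    (\int[P]_z ((\1_A (iter (q k) Rt z) - \1_A z : R) ^+ 2)%:E <= (1 * 2^-1 ^+ n)%:E)%E.
  move=> n; have e0 : 0 < 1 * (2^-1 : R) ^+ n by rewrite mul1r exprn_gt0.
  have rA0 m : (0 <= \int[P]_z ((\1_A (iter (q m) Rt z) - \1_A z : R) ^+ 2)%:E)%E.
    by apply: integral_ge0 => z _; rewrite lee_fin sqr_ge0.
  have [N _ hN] := (ge0_cvge0P rA0).1 rA _ e0.
  exists (maxn N n); split; first exact: leq_maxr.
  by apply: hN => /=; exact: leq_maxl.
have cA : {ae P, forall z, (\1_A (iter (q (k n)) Rt z) : R) @[n --> \oo] --> (\1_A z : R)}.
  have : {ae P, forall z, (\1_A (iter (q (k n)) Rt z) - \1_A z : R) ^+ 2 @[n --> \oo] --> 0}.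
    apply: (ae_cvg0 (C := 1) (f := fun n z => (\1_A (iter (q (k n)) Rt z) - \1_A z : R) ^+ 2)) => [n|n z|n].
    - exact: mdiff.
    - exact: sqr_ge0.
    - by case: (kP n).
  by apply: filterS => z /sqr_cvg0 h; exact/subr_cvg0.
have QC : q (k n) @[n --> \oo] --> \oo.
  apply: (cvg_comp k q) qoo.
  by apply/cvgnyPge => m; exists m => // n /= mn; apply: leq_trans (kP n).1.
pose u x := fine (nu (xsection A x)).
have mu_ : measurable_fun setT u.
  by apply: measurableT_comp => //; exact: measurable_fun_xsection.
have uE V x : measure_preserving nu V ->
    (u x)%:E = (\int[nu]_y (\1_A (x, V y))%:E)%E.
  move=> pV; rewrite fineK ?fin_num_measure//; last exact: measurable_xsection.
  have mxA : measurable (xsection A x) by exact: measurable_xsection.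
  rewrite (_ : (fun y => _) = fun y => (\1_(xsection A x) (V y))%:E); last first.
    by apply/funext => y; rewrite !indicE mem_xsection.
  rewrite (ge0_integral_measure_preserving (f := fun y => (\1_(xsection A x) y)%:E) pV).
  - by rewrite integral_indic// setIT.
  - exact/measurable_EFinP/measurable_indic.
  - by move=> y; rewrite lee_fin.
have [c uc] : exists c, {ae mu, forall x, u x = c}.
  apply: (mildly_mixing_rigid_function mm QC mu_).
  apply: filterS (ae_xsection cA) => x cx.
  have pF n := measure_preserving_fiber_iter T phi aS n x.
  have UE n : (u (iter (q (k n)) T x))%:E =
      (\int[nu]_y (\1_A (iter (q (k n)) Rt (x, y)))%:E)%E.
    rewrite (uE _ _ (pF (q (k n)))).
    by apply: eq_integral => y _; rewrite iter_rokhlin_extension.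
  have mAx n : measurable_fun setT (fun y => (\1_A (iter n Rt (x, y)) : R)).
    have h := measurableT_comp mI (pRtn n).1.
    apply: (measurableT_comp h (g := fun y => (x, y))).
    by apply/measurable_fun_pair => //; exact: measurable_cst.
  have [n|||||_ _] := @dominated_convergence _ _ _ nu setT measurableT
    (fun n y => (\1_A (iter (q (k n)) Rt (x, y)))%:E) (fun y => (\1_A (x, y))%:E) (cst 1%E).
  - exact/measurable_EFinP/mAx.
  - exact/measurable_EFinP/(mAx 0%N).
  - by apply: filterS cx => y cy _; apply/fine_cvgP; split => //; exact: nearW.
  - exact: finite_measure_integrable_cst.
  - by apply: aeW => y n _; rewrite lee_fin indicE; case: (_ \in A); rewrite ?normr1 ?normr0.
  rewrite -(uE id x (measure_preserving_id nu)).
  rewrite (_ : [sequence _]_n = fun n => (u (iter (q (k n)) T x))%:E); last first.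
    by apply/funext => n; rewrite UE.
  by move=> /fine_cvgP[_].
exists c; apply: filterS uc => x <-.
by rewrite fineK// fin_num_measure//; exact: measurable_xsection.
Qed.

End RigidSets.

Section RigidSetsTrivial.
Context {R : realType} {dX} {X : measurableType dX} {dY} {Y : measurableType dY}.
Context {G : topologicalZmodType}.
Variables (mu : probability X R) (nu : probability Y R).
Variables (T : X -> X) (phi : X -> borel_group G) (S : G -> Y -> Y).
Variable sigma : {finite_measure set (borel (dual R G)) -> \bar R}.
Variables (q : nat -> nat) (A : set (X * Y)).
Hypotheses (G2 : @second_countable G) (mm : mildly_mixing mu T)
  (mphi : measurable_fun setT phi) (aS : measurable_action nu S)
  (spec : is_maximal_spectral_type nu S sigma)
  (sigma0 : sigma.-negligible (Sigma_group mu T phi))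
  (qoo : q n @[n --> \oo] --> \oo) (mA : measurable A).

Local Notation Rt := (rokhlin_extension T phi S).
Let P : probability (X * Y)%type R := [the probability _ _ of (mu \x nu)%E].

Hypothesis rA : (\int[P]_z
  ((\1_A (iter (q n) Rt z) - \1_A z : R) ^+ 2)%:E)%E @[n --> \oo] --> 0%E.

(** [\1_C] is the constant [nu C] plus a zero-mean function. Orthogonality removes the latter, and
    the constant fibre measure computes the contribution of the former. *)
Lemma rigid_set_rectangle (c : R) (B : set X) (C : set Y) :
  {ae mu, forall x, nu (xsection A x) = c%:E} -> measurable B -> measurable C ->
  P (A `&` (B `*` C)) = (c%:E * (mu B * nu C))%E.
Proof.
move=> uc mB mC.
have bB : bounded_measurable (\1_B : X -> R) by exact: bounded_measurable_indic.
pose f y : R := \1_C y - fine (nu C).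
have nuC : (fine (nu C))%:E = nu C by rewrite fineK// fin_num_measure.
have bC : bounded_measurable (\1_C : Y -> R) by exact: bounded_measurable_indic.
have bf : bounded_measurable f.
  by apply: bounded_measurableB => //; exact: bounded_measurable_cst.
have int_f : \int[nu]_y f y = 0.
  rewrite RintegralB//; [|exact: bounded_measurable_integrable|]; last first.
    exact: (bounded_measurable_integrable _ (bounded_measurable_cst _)).
  rewrite Rintegral_cst// [fine (_ setT)](_ : _ = 1) ?mulr1; last first.
    exact: (congr1 fine (@probability_setT _ _ _ nu)).
  by rewrite /Rintegral integral_indic// setIT subrr.
have f20 : L20 nu (fun y => (f y)%:C%C).
  split; last first.
    by rewrite /integralC /= int_f /Rintegral integral0.
  split; first by split => /=; [case: bf|exact: measurable_cst].
  rewrite sqnorm2E /=.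
  have := integrable_fin_num measurableT (bounded_measurable_integrable nu (bounded_measurableM bf bf)).
  rewrite fin_numElt => /andP[_]; apply: le_lt_trans.
  by rewrite le_eqVlt; apply/orP; left; apply/eqP/eq_integral => y _ /=; rewrite expr0n /= addr0 expr2.
have [tau ftau tausigma] := spec.1 _ f20.
have := rigid_set_orthogonal G2 mm mphi aS bB bf ftau tausigma sigma0 qoo mA rA.
have PBT : P (A `&` (B `*` setT)) = (c%:E * mu B)%E.
  have mABT : measurable (A `&` (B `*` setT)) by apply: measurableI => //; exact: measurableX.
  transitivity (\int[mu]_x (c%:E * (\1_B x)%:E))%E; last first.
    rewrite integralZl//; last exact: (bounded_measurable_integrable _ bB).
    by rewrite integral_indic// setIT.
  apply: ae_eq_integral => //.
  - exact: measurable_fun_xsection.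
  - by apply: measurable_funeM; apply/measurable_EFinP; case: bB.
  apply: filterS uc => x ux _ /=; rewrite indicE.
  have [xB|xB] := boolP (x \in B).
    rewrite mule1 -ux; congr (nu _); apply/seteqP; split => y /= /xsectionP.
      by case=> ? _; exact/xsectionP.
    by move=> h; apply/xsectionP; split => //; split => //=; exact: set_mem.
  rewrite mule0; have -> : xsection (A `&` (B `*` setT)) x = set0; last exact: measure0.
  apply/seteqP; split => // y /= /xsectionP[_ [/= Bx _]].
  by move: xB; rewrite notin_setE.
have mABC : measurable (A `&` (B `*` C)) by apply: measurableI => //; exact: measurableX.
have mABT : measurable (A `&` (B `*` setT)) by apply: measurableI => //; exact: measurableX.
have bABC := bounded_measurable_indic (R := R) mABC.
have bABT := bounded_measurable_indic (R := R) mABT.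
have indE D : measurable D -> \int[P]_z (\1_D z : R) = fine (P D).
  by move=> mD; rewrite /Rintegral integral_indic// setIT.
have -> : \int[P]_z (\1_A z * (\1_B z.1 * f z.2)) =
    fine (P (A `&` (B `*` C))) - fine (nu C) * fine (P (A `&` (B `*` setT))).
  rewrite -!indE// -RintegralZl//; last exact: bounded_measurable_integrable.
  rewrite -RintegralB//; [|exact: bounded_measurable_integrable|]; last first.
    exact: (bounded_measurable_integrable _ (bounded_measurableZ _ bABT)).
  apply: eq_Rintegral => -[x y] _ /=; rewrite /f !indicE !(in_setI _ A) !classical_sets.in_setX /= classical_sets.in_setT.
  by case: (_ \in A); case: (_ \in B); case: (_ \in C); rewrite /=; ring.
have PBCfin : (fine (P (A `&` (B `*` C))))%:E = P (A `&` (B `*` C)).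
  by rewrite fineK// fin_num_measure.
rewrite PBT => /eqP; rewrite subr_eq0 => /eqP PBC.
rewrite -PBCfin PBC EFinM nuC fineK; last first.
  by rewrite fin_numM// fin_num_measure.
by rewrite muleC -muleA.
Qed.

Lemma rigid_set_trivial : P A = 0%E \/ P (~` A) = 0%E.
Proof.
have [c uc] := rigid_set_fiber_measure mm mphi aS qoo mA rA.
have rect B C := @rigid_set_rectangle c B C uc.
have PAc : P A = c%:E.
  have := rect setT setT measurableT measurableT.
  by rewrite setXTT setIT (@probability_setT _ _ _ mu) (@probability_setT _ _ _ nu) !mule1.
have c0 : 0 <= c by rewrite -lee_fin -PAc.
have [c00|cn0] := eqVneq c 0; first by left; rewrite PAc c00.
right.
have cinv : 0 <= c^-1 by rewrite invr_ge0.
(* This is [P] conditioned on [A]. It agrees with [mu \x nu] on rectangles, hence everywhere, and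
   its value at [A] is 1. *)
pose m' : {measure set (X * Y) -> \bar R} := mscale (NngNum cinv) (mrestr P mA).
have m'E D : m' D = ((c^-1)%:E * P (A `&` D))%E by rewrite setIC.
have : (mu \x nu)%E A = m' A.
  apply: product_measure_unique => // B C mB mC.
  by rewrite m'E rect// muleA -EFinM mulVf// mul1e.
have -> : m' A = 1%E.
  by rewrite m'E setIid PAc -EFinM mulVf.
move=> A1; rewrite probability_setC//.
by rewrite (_ : P A = 1%E)// subee.
Qed.

End RigidSetsTrivial.

Theorem proposition10 (R : realType)
  (dX : measure_display) (X : measurableType dX) (mu : probability X R)
  (dY : measure_display) (Y : measurableType dY) (nu : probability Y R)
  (G : topologicalZmodType)
  (T : X -> X) (phi : X -> borel_group G) (S : G -> Y -> Y)
  (sigma : {finite_measure set (borel (dual R G)) -> \bar R}) :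
  standard_borel R X -> standard_borel R Y ->
  hausdorff_space G -> locally_compact [set: G] -> @second_countable G ->
  automorphism mu T ->
  measurable_fun setT phi ->
  measurable_action nu S ->
  is_maximal_spectral_type nu S sigma ->
  mildly_mixing mu T ->
  sigma.-negligible (Sigma_group mu T phi) ->
  mildly_mixing (mu \x nu)%E (rokhlin_extension T phi S).
Proof.
move=> _ sY _ _ G2 aT mphi aS spec mm sigma0; split.
  exact: rokhlin_extension_automorphism.
move=> F [sF Fm _ _] [q [qoo rF]] A FA.
have mA : measurable A by exact: Fm.
have mI : measurable_fun setT (\1_A : X * Y -> R) by exact: measurable_indic.
apply: (rigid_set_trivial G2 mm mphi aS spec sigma0 qoo mA).
(* Rigidity of the factor is stated for complex functions, so it is applied to the indicator of [A]
   with zero imaginary part. *)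
have := rF (fun z => (\1_A z)%:C%C).
rewrite (_ : (fun n => sqnorm2 _ _) = fun n => (\int[(mu \x nu)%E]_z
   ((\1_A (iter (q n) (rokhlin_extension T phi S) z) - \1_A z : R) ^+ 2)%:E)%E); last first.
  apply/funext => n; rewrite sqnorm2E; apply: eq_integral => z _ /=.
  by rewrite subr0 expr0n /= addr0.
apply.
- split; first by split => //=; exact: measurable_cst.
  rewrite sqnorm2E /=; apply: (@le_lt_trans _ _ (\int[(mu \x nu)%E]_z (\1_A z)%:E)%E).
    rewrite le_eqVlt; apply/orP; left; apply/eqP/eq_integral => z _ /=.
    by rewrite indicE expr0n /= addr0; case: (_ \in A); rewrite /= ?expr1n ?expr0n.
  rewrite integral_indic// setIT; apply: (le_lt_trans _ (ltry 1)).
  exact: (@probability_le1 _ _ _ [the probability _ _ of (mu \x nu)%E]).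
- split => /=; last exact: measurable_cst.
  by apply: measurable_indic; exact: sub_sigma_algebra.
Qed.
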